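(* The center $\mathsf{Z}$ of $\mathsf{H}$ is generated as an algebra by $x_1^\ell,\ldots,x_n^\ell$ and $w$.
   Context: Fix integers $n\ge 3$ and $\ell\ge 2$, and let $\zeta$ be a primitive $\ell$-th root of unity. All subscripts are taken modulo $n$. Let $V=\mathbb{C}^n$ with standard basis $x_1,\ldots,x_n$, and let $G$ be the group of all diagonal matrices $g\in SL_n(\mathbb{C})$ with $g^\ell=1$, acting on $TV$. For $i=1,\ldots,n$ let $g_i\in G$ be given by $g_i(x_i)=\zeta x_i$, $g_i(x_{i+1})=\zeta^{-1}x_{i+1}$, $g_i(x_j)=x_j$ otherwise; $g_1,\ldots,g_{n-1}$ freely generate $G$ and $g_n=g_1^{-1}\cdots g_{n-1}^{-1}$. Define the 2-cocycle $\alpha$ by $\alpha(g_1^{i_1}\cdots g_{n-1}^{i_{n-1}},g_1^{j_1}\cdots g_{n-1}^{j_{n-1}})=\zeta^{-i_1j_2-\cdots-i_{n-2}j_{n-1}}$. For an algebra $E$ with $G$-action, $E\#_\alpha G$ is $E\otimes\mathbb{C}G$ with product $(r\otimes g)(s\otimes h)=\alpha(g,h)\,r\,(g\cdot s)\otimes gh$; for $g,h\in G$ write $g*h=\alpha(g,h)gh$. Let $t\in\mathbb{C}^n$. $\mathsf{H}$ is the quotient of $TV\#_\alpha G$ by the relations $x_ix_{i+1}-x_{i+1}x_i=t_ig_i$ for all $i$, and $x_ix_j=x_jx_i$ whenever $|i-j|\notin\{1,n-1\}$. For $p\in\mathbb{Z}_{\ge0}^n$, $x^p=x_1^{p_1}\cdots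 x_n^{p_n}$. Set $\tau_i=t_i/(\zeta-1)$ for $i<n$ and $\tau_n=\zeta t_n/(\zeta-1)$. Let $J$ be the set of subsets $\{i_1<\cdots<i_k\}\subseteq\{1,\ldots,n\}$ ($k\ge0$) with $|i_r-i_s|\notin\{1,n-1\}$ for all $r,s$. Let $\delta=(1,\ldots,1)\in\mathbb{Z}^n$ and $\varepsilon_i=e_i+e_{i+1}$ (so $\varepsilon_n=e_n+e_1$). Define $w=\sum_{\{i_1<\cdots<i_k\}\in J}\tau_{i_1}\cdots\tau_{i_k}\,x^{\delta-\varepsilon_{i_1}-\cdots-\varepsilon_{i_k}}\,g_{i_1}*\cdots*g_{i_k}\in\mathsf{H}$. *)

(* Defs.v *)
From HB Require Import structures.
From mathcomp Require Import all_boot all_order all_algebra.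
Set Implicit Arguments.
Unset Strict Implicit.
Unset Printing Implicit Defensive.
Import GRing.Theory Num.Theory.
Local Open Scope ring_scope.

(* The algebra H is encoded concretely: TV #_alpha G has the vector-space basis
   { (word in x_1..x_n) (x) g : g in G }.  An element of TV #_alpha G is a formal
   finite linear combination (a list of (coefficient, basis element)); two lists
   represent the same element iff their coefficient functions agree.  H is the
   quotient by the two-sided ideal generated by the relators, so equality in H
   is "difference lies in the ideal". Indices are 0-based: x_i is (ex i), i : 'I_n. *)

Section HAlgebra.
Variables (C : fieldType) (n l : nat) (zeta : C) (t : 'I_n -> C).

(* G, written in the coordinates (i_1,...,i_{n-1}) w.r.t. the free generators
   g_1,...,g_{n-1} (each of order l): g = g_1^{i_1} ... g_{n-1}^{i_{n-1}}. *)
Definition grp := {ffun 'I_n.-1 -> 'Z_l}.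
Definition gmul (g h : grp) : grp := [ffun k => g k + h k].
Definition gone : grp := [ffun => 0].

(* coordinate i_{m+1} of g as a natural number in [0, l) (0 if out of range) *)
Definition gc (g : grp) (m : nat) : nat := (\sum_(k : 'I_n.-1 | val k == m) val (g k))%N.

Definition alpha (g h : grp) : C := zeta ^- (\sum_(m < n.-2) gc g m * gc h m.+1)%N.

(* scalar by which the generator g_{k+1} acts on x_{j+1} *)
Definition sc (k : 'I_n.-1) (j : 'I_n) : C :=
  if val j == val k then zeta else if val j == (val k).+1 then zeta^-1 else 1.
Definition act (g : grp) (j : 'I_n) : C := \prod_(k : 'I_n.-1) sc k j ^+ val (g k).
Definition actw (g : grp) (w : seq 'I_n) : C := \prod_(j <- w) act g j.

Definition basis := (seq 'I_n * grp)%type.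
Definition elt := seq (C * basis).

Definition coef (f : elt) (b : basis) : C := \sum_(p <- f | p.2 == b) p.1.

(* (r (x) g)(s (x) h) = alpha(g,h) r (g.s) (x) gh on basis elements *)
Definition mulb (a b : basis) : C * basis :=
  (alpha a.2 b.2 * actw a.2 b.1, (a.1 ++ b.1, gmul a.2 b.2)).

Definition emul (f g : elt) : elt :=
  [seq (p.1 * q.1 * (mulb p.2 q.2).1, (mulb p.2 q.2).2) | p <- f, q <- g].
Definition escale (c : C) (f : elt) : elt := [seq (c * p.1, p.2) | p <- f].
Definition eadd (f g : elt) : elt := f ++ g.
Definition esub (f g : elt) : elt := f ++ escale (-1) g.
Definition eone : elt := [:: (1, ([::], gone))].
Definition ebas (b : basis) : elt := [:: (1, b)].
Definition ex (i : 'I_n) : elt := [:: (1, ([:: i], gone))].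
Definition eg (g : grp) : elt := [:: (1, ([::], g))].

(* g_{i+1} for i : 'I_n (0-based): g_i for i < n, and g_n = g_1^{-1}...g_{n-1}^{-1} *)
Definition gen_g (i : 'I_n) : grp :=
  [ffun k : 'I_n.-1 => if val i == n.-1 then -1 else if val k == val i then 1 else 0].

Definition dist (i j : 'I_n) : nat := (maxn i j - minn i j)%N.
Definition nonadj (i j : 'I_n) : bool := (dist i j != 1%N) && (dist i j != n.-1).

Definition is_rel (r : elt) : Prop :=
  (exists i : 'I_n,
      r = esub (esub (emul (ex i) (ex (ordS i))) (emul (ex (ordS i)) (ex i)))
               (escale (t i) (eg (gen_g i))))
  \/ (exists i j : 'I_n, nonadj i j /\ r = esub (emul (ex i) (ex j)) (emul (ex j) (ex i))).

Definition in_ideal (f : elt) : Prop :=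
  exists s : seq (C * basis * elt * basis),
    (forall q, q \in s -> is_rel q.1.2) /\
    forall b, coef f b =
      coef (flatten [seq escale q.1.1.1 (emul (emul (ebas q.1.1.2) q.1.2) (ebas q.2))
                    | q <- s]) b.

Definition eqH (f g : elt) : Prop := in_ideal (esub f g).

Definition central (z : elt) : Prop := forall y : elt, eqH (emul z y) (emul y z).

Definition tau (i : 'I_n) : C :=
  (if val i == n.-1 then zeta * t i else t i) / (zeta - 1).

Definition Jset : {set {set 'I_n}} :=
  [set A : {set 'I_n} | [forall i in A, forall j in A, nonadj i j]].

(* exponent of x_{j+1} in delta - eps_{i_1} - ... - eps_{i_k} *)
Definition pexp (A : {set 'I_n}) (j : 'I_n) : nat :=
  (1 - ((j \in A) + (ord_pred j \in A)))%N.

Definition xmon (A : {set 'I_n}) : elt :=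
  [:: (1, (flatten [seq nseq (pexp A j) j | j <- enum 'I_n], gone))].

Definition gprod (A : {set 'I_n}) : elt :=
  foldr (fun i acc => emul (eg (gen_g i)) acc) eone (enum A).

Definition w : elt :=
  flatten [seq escale (\prod_(i in A) tau i) (emul (xmon A) (gprod A)) | A : {set 'I_n} <- enum Jset].

Definition gens (o : option 'I_n) : elt :=
  if o is Some i then iter l (emul (ex i)) eone else w.

Definition emonom (s : seq (option 'I_n)) : elt :=
  foldr (fun o acc => emul (gens o) acc) eone s.

Definition in_subalg (z : elt) : Prop :=
  exists s : seq (C * seq (option 'I_n)),
    eqH z (flatten [seq escale c.1 (emonom c.2) | c <- s]).

End HAlgebra.

(* Main.v *)
Require Import Defs.
From HB Require Import structures.
From mathcomp Require Import all_boot all_order all_algebra.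
From mathcomp Require Import finmap monalg zify ring.
Set Implicit Arguments.
Unset Strict Implicit.
Unset Printing Implicit Defensive.
Import Order.TTheory GRing.Theory Num.Theory.
Local Open Scope ring_scope.

(* Let S be the twisted group algebra of Z^n x G, i.e. the skew group algebra of
   G over Laurent polynomials.  The elements X_i = x_i + v_i of S, with
   v_i = t_i/(zeta^-1 - 1) x_{i+1}^-1 g_i, satisfy the relations of H, and X_i is
   x_i up to terms of lower degree; as H is spanned by the ordered monomials,
   phi : x_i |-> X_i embeds H into S and every ordered monomial has the expected
   leading term.  The v_i commute with each other, v_i x_{i+1} = - tau_i g_i for
   i < n, and x_1 v_n = - tau_n g_n, so all the mixed terms of phi(w) cancel and
   phi(w) = x_1...x_n + v_1...v_n, which is central in S.  The x_i^l are central
   since 1 + zeta + ... + zeta^(l-1) = 0.  Conversely the top degree part of a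
   central element is central in S, hence a polynomial in the x_i whose exponents
   are all congruent mod l; subtracting the corresponding polynomial in w and the
   x_i^l lowers the degree. *)

(** * Twisted group algebras *)

Section LinearExtension.
Variables (K : choiceType) (R : nzRingType) (V : lmodType R).
Implicit Types (f g : {malg R[K]}) (h : K -> V).

Definition lext h f : V := \sum_(k <- msupp f) f@_k *: h k.

Lemma lextEw (d : {fset K}) h f :
  (msupp f `<=` d)%fset -> lext h f = \sum_(k <- d) f@_k *: h k.
Proof.
move=> sub_d; apply: big_fset_incl => // k _ /mcoeff_outdom ->.
by rewrite scale0r.
Qed.

Lemma lext_is_linear h : linear (lext h).
Proof.
move=> a f g; set d := (msupp f `|` msupp g)%fset.
rewrite (@lextEw d h f) ?fsubsetUl // (@lextEw d h g) ?fsubsetUr //.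
rewrite (@lextEw d) ?scaler_sumr -?big_split /=.
  by apply: eq_bigr => k _; rewrite mcoeffD mcoeffZ scalerDl scalerA.
apply: fsubset_trans (msuppD_le _ _) _; apply: fsetSU; exact: msuppZ_le.
Qed.

HB.instance Definition _ h :=
  GRing.isLinear.Build R {malg R[K]} V _ (lext h) (lext_is_linear h).

Lemma lextU h a k : lext h << a *g k >> = a *: h k.
Proof. by rewrite (lextEw h msuppU_le) big_seq_fset1 mcoeffUU. Qed.

Lemma malgE_lext f : f = \sum_(k <- msupp f) f@_k *: << k >>.
Proof.
rewrite {1}[f]monalgE; apply: eq_bigr => k _.
by apply/malgP=> k'; rewrite mcoeffZ !mcoeffU mulr_natr.
Qed.

End LinearExtension.

(** Over a ring, multiplicativity only makes [bichar 0 a] idempotent, so the normalisation at 0 is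
    required separately. *)
Record bicharacter (K : zmodType) (R : comNzRingType) := Bicharacter {
  bichar :> K -> K -> R;
  bicharDl : forall a b c, bichar (a + b) c = bichar a c * bichar b c;
  bicharDr : forall a b c, bichar a (b + c) = bichar a b * bichar a c;
  bichar0l : forall a, bichar 0 a = 1;
  bichar0r : forall a, bichar a 0 = 1 }.

Definition twalg (K : zmodType) (R : comNzRingType) (b : bicharacter K R) :=
  {malg R[K]}.

Section TwistedGroupAlgebra.
Variables (K : zmodType) (R : comNzRingType) (b : bicharacter K R).
Local Notation S := (twalg b).
Implicit Types (f g : S) (k : K).

HB.instance Definition _ := GRing.Lmodule.on S.

Definition tgmon k : S := << k >>.

Lemma twalgE f : f = \sum_(k <- msupp f) f@_k *: tgmon k.
Proof. exact: malgE_lext. Qed.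

Fact twmul_key : unit. Proof. by []. Qed.
Definition twmul : S -> S -> S := locked_with twmul_key (fun f g =>
  lext (fun k => lext (fun k' => b k k' *: tgmon (k + k')) g) f).

Lemma twmulE f g :
  twmul f g = lext (fun k => lext (fun k' => b k k' *: tgmon (k + k')) g) f.
Proof. by rewrite /twmul unlock. Qed.

Lemma twmulUU k k' : twmul (tgmon k) (tgmon k') = b k k' *: tgmon (k + k').
Proof. by rewrite !twmulE !lextU !scale1r. Qed.

Lemma twmulDl : left_distributive twmul +%R.
Proof. by move=> f f' g; rewrite !twmulE linearD. Qed.

Lemma twmulDr : right_distributive twmul +%R.
Proof.
move=> f g g'; rewrite !twmulE /lext -big_split /=; apply: eq_bigr => k _.
by rewrite -scalerDr; congr (_ *: _); exact: (linearD (lext _)).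
Qed.

Lemma twmulZl a f g : twmul (a *: f) g = a *: twmul f g.
Proof. by rewrite !twmulE linearZ. Qed.

Lemma twmulZr a f g : twmul f (a *: g) = a *: twmul f g.
Proof.
rewrite !twmulE /lext scaler_sumr; apply: eq_bigr => k _.
rewrite scalerA mulrC -scalerA; congr (_ *: _); exact: (linearZ_LR (lext _)).
Qed.

Lemma twmul_suml I (r : seq I) (F : I -> S) g :
  twmul (\sum_(i <- r) F i) g = \sum_(i <- r) twmul (F i) g.
Proof.
by apply: (big_morph (twmul^~ g) (fun _ _ => twmulDl _ _ _)); rewrite !twmulE linear0.
Qed.

Lemma twmul_sumr I (r : seq I) (F : I -> S) g :
  twmul g (\sum_(i <- r) F i) = \sum_(i <- r) twmul g (F i).
Proof.
apply: (big_morph (twmul g) (fun _ _ => twmulDr _ _ _)).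
by have := twmulZr 0 g 0; rewrite !scale0r.
Qed.

(** A bicharacter is a 2-cocycle: on basis elements both bracketings give the scalar b(k,k')
    b(k,k'') b(k',k''). *)
Lemma twmulA : associative twmul.
Proof.
move=> f g h; rewrite (twalgE f).
rewrite (twmul_suml _ _ (twmul g h)) (twmul_suml _ _ g) (twmul_suml _ _ h).
apply: eq_bigr => k _; rewrite !twmulZl (twalgE g); congr (_ *: _).
rewrite (twmul_suml _ _ h) !(twmul_sumr _ _ (tgmon k)) (twmul_suml _ _ h).
apply: eq_bigr => k' _; rewrite !(twmulZl, twmulZr) (twalgE h); congr (_ *: _).
rewrite (twmul_sumr _ _ (tgmon k')) (twmul_sumr _ _ (tgmon k)).
rewrite (twmul_sumr _ _ (twmul (tgmon k) (tgmon k'))); apply: eq_bigr => k'' _.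
rewrite !(twmulZl, twmulZr, twmulUU) bicharDl bicharDr addrA !scalerA.
by congr (_ *: _); rewrite mulrC mulrACA.
Qed.

Lemma twmul1 : left_id (tgmon 0) twmul.
Proof.
move=> f; rewrite {1}(twalgE f) twmul_sumr [RHS]twalgE; apply: eq_bigr => k _.
by rewrite twmulZr twmulUU bichar0l add0r scale1r.
Qed.

Lemma twmulr1 : right_id (tgmon 0) twmul.
Proof.
move=> f; rewrite {1}(twalgE f) twmul_suml [RHS]twalgE; apply: eq_bigr => k _.
by rewrite twmulZl twmulUU bichar0r addr0 scale1r.
Qed.

Lemma tgmon0_neq0 : tgmon 0 != 0.
Proof.
by apply/eqP => /(congr1 (mcoeff 0))/eqP; rewrite mcoeffUU mcoeff0 oner_eq0.
Qed.

HB.instance Definition _ := GRing.Zmodule_isNzRing.Build S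
  twmulA twmul1 twmulr1 twmulDl twmulDr tgmon0_neq0.
HB.instance Definition _ := GRing.Lmodule_isLalgebra.Build R S
  (fun a f g => esym (twmulZl a f g)).
HB.instance Definition _ := GRing.Lalgebra_isAlgebra.Build R S
  (fun a f g => esym (twmulZr a f g)).

End TwistedGroupAlgebra.

(* An abstract interface: with a transparent construction the unifier unfolds it
   at every product. *)
Record twisted_algebra (K : zmodType) (R : comNzRingType)
    (b : bicharacter K R) := TwistedAlgebra {
  tw_alg :> algType R;
  twmon : K -> tw_alg;
  twcoef : K -> tw_alg -> R;
  twcoef_is_linear : forall k, scalar (twcoef k);
  twcoef_mon : forall k k', twcoef k' (twmon k) = (k == k')%:R;
  twmon_span : forall f, {s | f = \sum_(k <- s) twcoef k f *: twmon k};
  twmonM : forall k k', twmon k * twmon k' = b k k' *: twmon (k + k');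
  twmon0 : twmon 0 = 1 }.

Lemma twisted_group_algebra (K : zmodType) (R : comNzRingType)
  (b : bicharacter K R) : twisted_algebra b.
Proof.
apply: (@TwistedAlgebra K R b (twalg b) (@tgmon K R b) (fun k f => f@_k)).
- by move=> k a f g; rewrite mcoeffD mcoeffZ.
- by move=> k k'; rewrite mcoeffU.
- by move=> f; exists (msupp f); exact: twalgE.
- exact: twmulUU.
- by [].
Qed.

Section TwistedAlgebraTheory.
Variables (K : zmodType) (R : comNzRingType) (b : bicharacter K R).
Variable S : twisted_algebra b.
Implicit Types (f g : S) (k : K).
Local Notation twmon := (@twmon K R b S).
Local Notation twcoef := (@twcoef K R b S).

HB.instance Definition _ k :=
  GRing.isLinear.Build R S R _ (twcoef k) (twcoef_is_linear k).

Lemma twcoef0 k : twcoef k 0 = 0.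
Proof. exact: linear0. Qed.

Lemma twcoefD k f g : twcoef k (f + g) = twcoef k f + twcoef k g.
Proof. exact: linearD. Qed.

Lemma twcoefB k f g : twcoef k (f - g) = twcoef k f - twcoef k g.
Proof. exact: linearB. Qed.

Lemma twcoefZ k a f : twcoef k (a *: f) = a * twcoef k f.
Proof. exact: linearZ. Qed.

Lemma twcoef_monM k f k' : twcoef k' (twmon k * f) = b k (k' - k) * twcoef (k' - k) f.
Proof.
have [s ->] := twmon_span f; rewrite mulr_sumr !linear_sum /= mulr_sumr.
apply: eq_bigr => i _; rewrite -scalerAr twmonM !twcoefZ !twcoef_mon.
have -> : (k + i == k') = (i == k' - k).
  by rewrite [RHS]eq_sym subr_eq [RHS]eq_sym addrC.
by case: eqP => [->|_]; rewrite ?mulr1 ?mulr0 // mulrC.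
Qed.

Lemma twcoefM_mon f k k' : twcoef k' (f * twmon k) = twcoef (k' - k) f * b (k' - k) k.
Proof.
have [s ->] := twmon_span f; rewrite mulr_suml !linear_sum /= mulr_suml.
apply: eq_bigr => i _; rewrite -scalerAl twmonM !twcoefZ !twcoef_mon.
have -> : (i + k == k') = (i == k' - k).
  by rewrite [RHS]eq_sym subr_eq [RHS]eq_sym.
by case: eqP => [->|_]; rewrite ?mulr1 ?mulr0 ?mul0r.
Qed.

Lemma twmon_central f : (forall k, GRing.comm f (twmon k)) ->
  forall g, GRing.comm f g.
Proof.
move=> fC g; have [s ->] := twmon_span g; apply: commr_sum => k _.
by rewrite /GRing.comm -scalerAr fC scalerAl.
Qed.

(** * Degree filtration and leading terms *)

Section Degree.
Variable deg : K -> int.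
Hypothesis degD : forall k k', deg (k + k') = deg k + deg k'.

Definition deg_lt (d : int) f := forall k, d <= deg k -> twcoef k f = 0.

(** The monomial is the whole top-degree component of [f], with coefficient 1, and not only its
    largest term for some order. *)
Definition leads k f := deg_lt (deg k) (f - twmon k).

Lemma deg_lt_le d d' f : d <= d' -> deg_lt d f -> deg_lt d' f.
Proof. by move=> dd' df k dk; apply: df; apply: le_trans dd' dk. Qed.

Lemma deg_ltD d f g : deg_lt d f -> deg_lt d g -> deg_lt d (f + g).
Proof. by move=> df dg k dk; rewrite twcoefD df ?dg ?addr0. Qed.

Lemma deg_ltZ d a f : deg_lt d f -> deg_lt d (a *: f).
Proof. by move=> df k dk; rewrite twcoefZ df ?mulr0. Qed.

Lemma deg_lt_sum d I (r : seq I) (P : pred I) (F : I -> S) :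
  (forall i, P i -> deg_lt d (F i)) -> deg_lt d (\sum_(i <- r | P i) F i).
Proof.
by move=> dF; elim/big_ind: _ => //;
  [move=> k _; rewrite twcoef0 | apply: deg_ltD].
Qed.

Lemma deg_lt_twmon d k : deg k < d -> deg_lt d (twmon k).
Proof.
by move=> dk k' dk'; rewrite twcoef_mon; case: eqP dk' => // <-; rewrite leNgt dk.
Qed.

(** Degrees are integers, so the bound [d' + 1] says that [g] has degree at most [d']. *)
Lemma deg_ltM d d' f g : deg_lt d f -> deg_lt (d' + 1) g -> deg_lt (d + d') (f * g).
Proof.
move=> df dg k dk; have [s {1}->] := twmon_span f.
rewrite mulr_suml linear_sum big1 //= => i _.
rewrite -scalerAl twcoefZ twcoef_monM.
have [/df->|lt_id] := leP d (deg i); first by rewrite mul0r.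
rewrite dg ?mulr0 //.
have -> : deg (k - i) = deg k - deg i by apply/eqP; rewrite eq_sym subr_eq -degD subrK.
rewrite lerBrDr; apply: le_trans dk.
by rewrite -addrA [1 + _]addrC [d + _]addrC lerD2l lezD1.
Qed.

Lemma leads_deg_lt k f : leads k f -> deg_lt (deg k + 1) f.
Proof.
move=> kf; rewrite -[f](subrK (twmon k)); apply: deg_ltD.
  by apply: deg_lt_le kf; rewrite lerDl.
by apply: deg_lt_twmon; rewrite ltrDl.
Qed.

Lemma leads_coef k f k' : leads k f -> deg k <= deg k' -> twcoef k' f = (k == k')%:R.
Proof.
move=> kf kk'; have := kf _ kk'; rewrite twcoefB twcoef_mon.
by move/eqP; rewrite subr_eq0 => /eqP.
Qed.

(** The error splits as (f - k) g + k (g - k'), both parts having lower degree; [b k k' = 1] keeps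
    the leading coefficient equal to 1. *)
Lemma leadsM k k' f g :
  leads k f -> leads k' g -> b k k' = 1 -> leads (k + k') (f * g).
Proof.
move=> kf kg b1; rewrite /leads degD.
have -> : f * g - twmon (k + k') = (f - twmon k) * g + twmon k * (g - twmon k').
  by rewrite mulrBl mulrBr twmonM b1 scale1r addrA subrK.
apply: deg_ltD; first by apply: deg_ltM; [|exact: leads_deg_lt].
rewrite addrC => j dj; rewrite twcoef_monM kg ?mulr0 //.
have -> : deg (j - k) = deg j - deg k by apply/eqP; rewrite eq_sym subr_eq -degD subrK.
by rewrite lerBrDr.
Qed.

End Degree.

End TwistedAlgebraTheory.

(** * Dimers on a cycle *)

Section TransferMatrices.
Variables (S : nzRingType) (N : nat).
Implicit Type A : {set 'I_N.+1}.

Lemma sum_subsets_step (V : nmodType) (F : {set 'I_N.+1} -> V) k :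
  (k < N.+1)%N ->
  \sum_(A : {set 'I_N.+1} | A \subset [pred i : 'I_N.+1 | (i < k.+1)%N])
    F A =
  \sum_(A : {set 'I_N.+1} | A \subset [pred i : 'I_N.+1 | (i < k)%N])
    (F A + F (inord k |: A)).
Proof.
move=> kN; have valk : (inord k : 'I_N.+1) = k :> nat by rewrite inordK.
rewrite big_split (bigID (fun A => inord k \notin A)) /=; congr (_ + _).
  apply: eq_bigl => A; apply/andP/subsetP => [[/subsetP Ak kA] i iA|Ak].
    have := Ak _ iA; rewrite !inE ltnS leq_eqVlt => /orP[/eqP ik|//].
    by case/negP: kA; rewrite -ik inord_val.
  split; first by apply/subsetP => i /Ak; rewrite !inE => /leqW.
  by apply/negP => /Ak; rewrite inE valk ltnn.
rewrite (reindex_onto (fun A => inord k |: A) (fun A => A :\ inord k)) /=; last first.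
  by move=> A /andP[_]; rewrite negbK => kA; rewrite setD1K.
apply: eq_bigl => A; rewrite setU11 andbT.
apply/andP/subsetP => [[/subsetP Ak /eqP AK] i iA|Ak].
  have : i \in (inord k |: A) :\ inord k by rewrite AK.
  rewrite !inE => /andP[ik _]; have := Ak i; rewrite !inE iA orbT => /(_ isT).
  rewrite ltnS leq_eqVlt => /orP[/eqP e|//].
  by case/negP: ik; rewrite -e inord_val.
split; last first.
  by rewrite setU1K //; apply/negP => /Ak; rewrite inE valk ltnn.
apply/subsetP => i; rewrite !inE => /orP[/eqP->|/Ak]; first by rewrite valk.
by rewrite inE => /leqW.
Qed.

(** The boundary state [a] stands for the site before 0; taking it to be the membership of the last
    index closes the cycle. *)
Definition prev_in (a : bool) A (k : nat) :=
  if k is k'.+1 then inord k' \in A else a.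

(** The sum is an ordered product of 2x2 matrices [M k] applied to the vector [V N.+1], and the
    hypothesis propagates this vector back to [V 0]. *)
Lemma transfer_sum (M : nat -> bool -> bool -> S) (V : nat -> bool -> S) a :
  (forall k c, (k <= N)%N ->
     V k c = M k c false * V k.+1 false + M k c true * V k.+1 true) ->
  \sum_(A : {set 'I_N.+1}) (\prod_(0 <= j < N.+1) M j (prev_in a A j) (inord j \in A))
         * V N.+1 (inord N \in A) = V 0 a.
Proof.
move=> VM.
suff H k : (k <= N.+1)%N ->
  \sum_(A : {set 'I_N.+1} | A \subset [pred i : 'I_N.+1 | (i < k)%N])
  (\prod_(0 <= j < k) M j (prev_in a A j) (inord j \in A)) * V k (prev_in a A k)
  = V 0%N a.
  rewrite -[RHS](H N.+1) //; apply: eq_bigl => A; symmetry.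
  by apply/subsetP => i _; rewrite inE.
elim: k => [_|k IHk kN].
  rewrite (big_pred1 set0) ?big_geq ?mul1r // => A /=.
  apply/subsetP/eqP => [sA|-> i]; last by rewrite inE.
  by apply/setP => i; rewrite inE; apply/negP => /sA; rewrite inE ltn0.
rewrite -[RHS]IHk 1?ltnW // sum_subsets_step //; apply: eq_bigr => A sA.
have valk : (inord k : 'I_N.+1) = k :> nat by rewrite inordK.
have kA : inord k \notin A.
  by apply/negP => /(subsetP sA); rewrite inE valk ltnn.
have inU (j : nat) : (j < k)%N -> (inord j \in inord k |: A) = (inord j \in A).
  move=> jk; rewrite !inE; case: eqP => // /(congr1 val) /=.
  by rewrite valk inordK ?(ltn_trans jk) // => e; rewrite e ltnn in jk.
have prU j : (j <= k)%N -> prev_in a (inord k |: A) j = prev_in a A j.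
  by case: j => //= j jk; rewrite inU.
rewrite !big_nat_recr //= setU11 (negPf kA) prU //.
rewrite [\prod_(0 <= j < k) M j (prev_in a (_ |: _) j) _](eq_big_nat _ _
  (F2 := fun j => M j (prev_in a A j) (inord j \in A))).
  by rewrite -!mulrA -mulrDr; congr (_ * _); rewrite [RHS]VM //.
by move=> j /andP[_ jk]; rewrite inU ?prU // ltnW.
Qed.

End TransferMatrices.

(** * Continuants and the dimer sum *)

Section Continuants.
Variables (S : nzRingType) (x v u : nat -> S).

(** Closed form of the continuant with entries x_j + v_j and dimer weights u_j = - v_j x_{j+1}: only
    words in which all x precede all v survive. It is 1 for [k = e] and 0 for [k > e]. *)
Definition cont (e k : nat) : S :=
  \sum_(k <= m < e.+1) (\prod_(k <= j < m) x j) * (\prod_(m <= j < e) v j).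

Lemma cont_gt e k : (e < k)%N -> cont e k = 0.
Proof. by move=> ek; rewrite /cont big_geq. Qed.

Lemma contE e k :
  (k <= e)%N -> cont e k = x k * cont e k.+1 + \prod_(k <= j < e) v j.
Proof.
move=> ke; rewrite /cont [LHS]big_ltn 1?ltnS // addrC; congr (_ + _); last first.
  by rewrite big_geq // mul1r.
rewrite mulr_sumr; apply: eq_big_nat => m /andP[km _].
by rewrite mulrA; congr (_ * _); rewrite big_ltn.
Qed.

Lemma cont_end e k : (k <= e)%N ->
  cont e.+1 k = \prod_(k <= j < e.+1) x j + cont e k * v e.
Proof.
move=> ke; rewrite /cont big_nat_recr /=; last by rewrite ltnW.
rewrite addrC; congr (_ + _); first by rewrite [X in _ * X]big_geq ?mulr1.
rewrite mulr_suml; apply: eq_big_nat => m /andP[_]; rewrite ltnS => me.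
by rewrite -mulrA [in LHS]big_nat_recr.
Qed.

(** Expanding [cont e k.+1] behind [v k] yields the mixed term v_k x_{k+1} [cont e k.+2], which
    [u k] cancels. For [k.+1 = e] the factor [cont e k.+2] is 0, hence the guard. *)
Lemma cont_transfer e k : (k < e)%N ->
  ((k.+1 < e)%N -> u k = - (v k * x k.+1)) ->
  cont e k = (x k + v k) * cont e k.+1 + u k * cont e k.+2.
Proof.
move=> ke uk; rewrite contE 1?ltnW // mulrDl -addrA; congr (_ + _).
rewrite [cont e k.+1]contE // mulrDr mulrA [in LHS]big_ltn //.
move: ke; rewrite leq_eqVlt => /orP[/eqP<-|/uk ->]; last first.
  by rewrite mulNr addrC addrA addNr add0r.
by rewrite !cont_gt // !mulr0 add0r addr0.
Qed.

(* The 2x2 transfer matrix of the dimer model on a cycle: the state records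
   whether the dimer (j, j+1) is present. *)
Definition dimer (j : nat) (a c : bool) : S :=
  if c then (if a then 0 else u j) else (if a then 1 else x j + v j).

Lemma cont_comm e k z : (forall j, (k <= j < e)%N -> GRing.comm z (x j)) ->
  (forall j, (k <= j < e)%N -> GRing.comm z (v j)) -> GRing.comm z (cont e k).
Proof.
move=> zx zv; rewrite /cont big_seq; apply: commr_sum => m; rewrite mem_index_iota.
rewrite ltnS => /andP[km me]; apply: commrM.
  rewrite big_seq; apply: commr_prod => j; rewrite mem_index_iota => /andP[kj jm].
  by apply: zx; rewrite kj (leq_trans jm).
rewrite big_seq; apply: commr_prod => j; rewrite mem_index_iota => /andP[mj je].
by apply: zv; rewrite je (leq_trans km).
Qed.

(** Split by whether the dimer joining N to 0 is present. Without it the sum is [cont N.+1 0]: the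
    two pure products and the mixed terms x_0 [cont N 1] v_N. With it the sum is [cont N 1 * u N],
    which cancels these since x_0 commutes with [cont N 1]. *)
Lemma dimer_sum N : (0 < N)%N ->
  (forall k, (k < N)%N -> u k = - (v k * x k.+1)) -> u N = - (x 0%N * v N) ->
  (forall k, (0 < k < N)%N -> GRing.comm (x 0%N) (x k)) ->
  (forall k, (0 < k < N)%N -> GRing.comm (x 0%N) (v k)) ->
  \sum_(A : {set 'I_N.+1}) \prod_(0 <= j < N.+1)
     dimer j (prev_in (ord_max \in A) A j) (inord j \in A)
  = \prod_(0 <= j < N.+1) x j + \prod_(0 <= j < N.+1) v j.
Proof.
move=> N_gt0 uE uN x0x x0v; have max_ord : inord N = ord_max :> 'I_N.+1.
  by apply/val_inj; rewrite /= inordK.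
(* [k + c] skips site [k] when the previous dimer covers it; for [a] true the last site carries the
   closing dimer, so the continuant stops at [N]. At [N.+1] the vector is the indicator of
   [c == a]. *)
pose V a k (c : bool) : S :=
  if a then if k == N.+1 then c%:R else cont N (k + c) * u N
  else cont N.+1 (k + c).
have VN a c : V a N.+1 c = (c == a)%:R.
  rewrite /V eqxx; case: a c => [] [] //; first by rewrite cont_gt // addn1.
  by rewrite addn0 /cont big_nat1 !big_geq ?mulr1.
rewrite (eq_bigr (fun A : {set 'I_N.+1} => \sum_(a : bool)
  (\prod_(0 <= j < N.+1) dimer j (prev_in a A j) (inord j \in A))
    * V a N.+1 (inord N \in A))); last first.
  move=> A _; rewrite big_bool !VN max_ord.
  by case: (ord_max \in A); rewrite /= mulr1n mulr0n mulr1 mulr0 ?addr0 ?add0r.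
rewrite exchange_big /= (eq_bigr (fun a => V a 0%N a)) => [|a _].
  rewrite big_bool /= /V /= add0n addn0 addrC contE // cont_end // mulrDr -!addrA.
  congr (_ + _); first by rewrite [RHS]big_ltn.
  rewrite addrC -addrA -[RHS]addr0 mulrA; congr (_ + _).
  have -> : x 0%N * cont N 1 = cont N 1 * x 0%N by apply: cont_comm.
  by rewrite -mulrA uN mulrN addNr.
apply: transfer_sum => k c kN; rewrite /dimer.
case: c => /=.
  rewrite mul0r mul1r addr0 /V addn1 addn0 eqSS; case: a => //.
  by rewrite (@ltn_eqF k N.+1) //; case: eqP => [->|//]; rewrite cont_gt ?mul0r.
rewrite /V !addn0 addn1; case: a; last by rewrite -cont_transfer // => /uE.
rewrite eqSS (@ltn_eqF k N.+1) //; case: eqP kN => [->|/eqP kN] kN'.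
  by rewrite mulr0 add0r mulr1 /cont big_nat1 !big_geq ?mulr1 ?mul1r.
have {}kN : (k < N)%N by rewrite ltn_neqAle kN.
by rewrite !mulrA -mulrDl -cont_transfer // => _; exact: uE.
Qed.

End Continuants.

(** * Commutators with powers *)

Section QCommutator.
Variables (R : comNzRingType) (S : algType R) (q : R) (a b c : S).
Hypotheses (ab : a * b - b * a = c) (ca : c * a = q *: (a * c)).

(** Leibniz rule: [a^(k+1), b] = a [a^k, b] + [a, b] a^k, and moving [c] past a^k costs q^k. For
    [k = 0] the sum is empty, so the truncated [k.-1] is harmless. *)
Lemma qcommutator_exp k :
  a ^+ k * b - b * a ^+ k = (\sum_(i < k) q ^+ i) *: (a ^+ k.-1 * c).
Proof.
elim: k => [|k IHk]; first by rewrite big_ord0 scale0r !expr0 mul1r mulr1 subrr.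
have ca' j : c * a ^+ j = q ^+ j *: (a ^+ j * c).
  elim: j => [|j IHj]; first by rewrite !expr0 mulr1 mul1r scale1r.
  rewrite [a ^+ _]exprS mulrA ca -scalerAl -[a * c * _]mulrA IHj.
  by rewrite -scalerAr scalerA mulrA -!exprS.
rewrite exprS [k.+1.-1]/= big_ord_recr /= scalerDl -ca'.
have -> : a * a ^+ k * b - b * (a * a ^+ k)
          = a * (a ^+ k * b - b * a ^+ k) + (a * b - b * a) * a ^+ k.
  by rewrite mulrBr mulrBl !mulrA addrA subrK.
rewrite ab IHk; congr (_ + _); case: k {IHk} => [|k].
  by rewrite big_ord0 !scale0r mulr0.
by rewrite -scalerAr mulrA -exprS.
Qed.

End QCommutator.

(** * Exponents of zeta *)

Section CyclicIndices.
Variable m : nat.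
Local Notation n := m.+3.
Implicit Types i j : 'I_n.

Lemma val_ordS i : val (ordS i) = if i == m.+2 :> nat then 0%N else i.+1.
Proof.
rewrite /=; case: eqP => [->|ne]; first by rewrite modnn.
by rewrite modn_small //; have := ltn_ord i; lia.
Qed.

Lemma val_ord_pred i : val (ord_pred i) = if i == 0 :> nat then m.+2 else i.-1.
Proof.
case: i => [[|i] ilt] /=; first by rewrite modn_small.
by rewrite modnDr modn_small // ltnW.
Qed.

Lemma ordS_neq i : ordS i != i.
Proof. by rewrite -val_eqE val_ordS /=; case: ifP; lia. Qed.

Lemma ordSS_neq i : ordS (ordS i) != i.
Proof.
by rewrite -val_eqE !val_ordS /=; do 2 case: ifP; have := ltn_ord i; lia.
Qed.

Lemma ordS_eq i j : (ordS i == j) = (i == ord_pred j).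
Proof. by apply/eqP/eqP => [<-|->]; rewrite ?ordSK ?ord_predK. Qed.

Lemma sum_ordS (V : nmodType) (F : 'I_n -> V) : \sum_i F (ordS i) = \sum_i F i.
Proof. by rewrite [RHS](reindex_inj (@ordS_inj _)). Qed.

(** Distance 1 or [n.-1] means that one index is the cyclic successor of the other. *)
Lemma nonadjE i j : nonadj i j = (j != ordS i) && (i != ordS j).
Proof.
rewrite /nonadj /dist -!val_eqE !val_ordS /=.
by move: (ltn_ord i) (ltn_ord j); do 2 case: ifP; lia.
Qed.

End CyclicIndices.

Section GroupExponents.
Variables (C : fieldType) (m l : nat) (zeta : C).
Hypotheses (l_gt1 : (1 < l)%N) (zeta_prim : l.-primitive_root zeta).
Local Notation n := m.+3.
Local Notation grp := {ffun 'I_n.-1 -> 'Z_l}.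
Implicit Types (g h : grp) (a b : 'Z_l) (i j : 'I_n).

Definition zp a : C := zeta ^+ a.

Lemma zpN_exp k : zeta ^+ k = zp k%:R.
Proof. by rewrite /zp val_Zp_nat // -[LHS](prim_expr_mod zeta_prim). Qed.

Lemma zp0 : zp 0 = 1.
Proof. by rewrite /zp expr0. Qed.

Lemma zpD a b : zp (a + b) = zp a * zp b.
Proof. by rewrite -{1}[a]natr_Zp -{1}[b]natr_Zp -natrD -zpN_exp exprD. Qed.

Lemma zpM a b : zeta ^+ (a * b) = zp (a * b).
Proof. by rewrite -{2}[a]natr_Zp -{2}[b]natr_Zp -natrM -zpN_exp. Qed.

Lemma zp1 : zp 1 = zeta.
Proof. by rewrite -[1]/(1%:R) -zpN_exp expr1. Qed.

Lemma zp_neq0 a : zp a != 0.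
Proof. by rewrite expf_neq0 // (prim_root_eq0 zeta_prim) -lt0n ltnW. Qed.

Lemma zpN a : zp (- a) = (zp a)^-1.
Proof.
by apply: (mulfI (zp_neq0 a)); rewrite -zpD subrr zp0 mulfV // zp_neq0.
Qed.

Lemma zp_prod (I : Type) (r : seq I) (P : pred I) (F : I -> 'Z_l) :
  zp (\sum_(i <- r | P i) F i) = \prod_(i <- r | P i) zp (F i).
Proof. exact: (big_morph _ zpD zp0). Qed.

Lemma zp_inj : injective zp.
Proof.
move=> a b /eqP; rewrite /zp (eq_prim_root_expr zeta_prim) => /eqP e.
have lZ (c : 'Z_l) : (c < l)%N by rewrite -[X in (_ < X)%N](Zp_cast l_gt1).
by apply/val_inj; rewrite !modn_small in e.
Qed.

Lemma zeta_neq0 : zeta != 0.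
Proof. by rewrite -zp1 zp_neq0. Qed.

Lemma zeta_neq1 : zeta != 1.
Proof.
apply/eqP => e; have : zeta ^+ 1 == 1 by rewrite e expr1n.
rewrite -(prim_order_dvd zeta_prim) dvdn1 => /eqP l1.
by move: l_gt1; rewrite l1.
Qed.

(* The last coordinate G g n.-1 is 0, so that the formulas below are cyclic in j. *)
Definition G g (j : nat) : 'Z_l := \sum_(k : 'I_n.-1 | val k == j) g k.

Lemma G_lt g (j : nat) (jn : (j < n.-1)%N) : G g j = g (Ordinal jn).
Proof. by rewrite /G (big_pred1 (Ordinal jn)). Qed.

Lemma G_ge g (j : nat) : (n.-1 <= j)%N -> G g j = 0.
Proof.
by move=> nj; rewrite /G big1 // => k /eqP kj; rewrite -kj leqNgt ltn_ord in nj.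
Qed.

Lemma GD g h (j : nat) : G (g + h) j = G g j + G h j.
Proof. by rewrite /G -big_split; apply: eq_bigr => k _; rewrite ffunE. Qed.

Lemma G0 (j : nat) : G 0 j = 0.
Proof. by rewrite /G big1 // => k _; rewrite ffunE. Qed.

Lemma gcE (g : Defs.grp n l) (j : nat) : gc g j = G g j :> nat.
Proof.
have [nj|jn] := leqP n.-1 j; last by rewrite G_lt /gc (big_pred1 (Ordinal jn)).
rewrite G_ge // /gc big1 // => k /eqP kj.
by move: nj; rewrite -kj leqNgt ltn_ord.
Qed.

(* The exponent of zeta by which g acts on x_j. *)
Definition wt g j : 'Z_l := G g j - G g (ord_pred j).

Lemma wtD g h j : wt (g + h) j = wt g j + wt h j.
Proof. by rewrite /wt !GD opprD addrACA. Qed.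

Lemma wt0 j : wt 0 j = 0.
Proof. by rewrite /wt !G0 subrr. Qed.

(** The weights telescope around the cycle; this is the determinant 1 condition on G. *)
Lemma sum_wt g : \sum_j wt g j = 0.
Proof.
rewrite /wt sumrB -(sum_ordS (fun j => G g (ord_pred j))).
rewrite [X in _ - X](eq_bigr (fun j : 'I_n => G g j)) ?subrr // => j _.
by rewrite ordSK.
Qed.

Lemma actE (g : Defs.grp n l) j : act zeta g j = zp (wt g j).
Proof.
rewrite /act /wt zpD zpN /G !zp_prod -prodfV.
have -> : \prod_(k : 'I_n.-1 | val k == ord_pred j) (zp (g k))^-1
        = \prod_(k : 'I_n.-1 | val j == (val k).+1) (zp (g k))^-1.
  apply: eq_bigl => k; rewrite val_ord_pred; have := ltn_ord k.
  by case: ifP => /=; lia.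
rewrite [X in _ = X * _]big_mkcond [X in _ = _ * X]big_mkcond -big_split.
apply: eq_bigr => k _.
rewrite /sc [val k == _]eq_sym; case: eqP => [->|_].
  by rewrite (ltn_eqF (ltnSn _)) /= mulr1.
by case: eqP => [_|_] /=; rewrite ?mul1r ?expr1n // exprVn.
Qed.

(** The terms meeting a last coordinate vanish, which leaves the exponent of [alpha] up to sign, in
    a cyclic form. *)
Definition pairing g h : 'Z_l := \sum_(j : 'I_n) G g j * G h (ordS j).

Lemma pairingDl g g' h : pairing (g + g') h = pairing g h + pairing g' h.
Proof. by rewrite /pairing -big_split; apply: eq_bigr => j _; rewrite GD mulrDl. Qed.

Lemma pairingDr g h h' : pairing g (h + h') = pairing g h + pairing g h'.
Proof. by rewrite /pairing -big_split; apply: eq_bigr => j _; rewrite GD mulrDr. Qed.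

Lemma pairing0l h : pairing 0 h = 0.
Proof. by rewrite /pairing big1 // => j _; rewrite G0 mul0r. Qed.

Lemma pairing0r g : pairing g 0 = 0.
Proof. by rewrite /pairing big1 // => j _; rewrite G0 mulr0. Qed.

Lemma alphaE (g h : Defs.grp n l) : alpha zeta g h = zp (- pairing g h).
Proof.
rewrite /alpha zpN; congr (_^-1).
have -> : pairing g h = \sum_(k < m.+1) G g k * G h k.+1.
  rewrite /pairing 2!big_ord_recr /= modnn (@modn_small m.+2) //.
  rewrite (@G_ge g m.+2) // mul0r addr0 (@G_ge h m.+2) // mulr0 addr0.
  apply: eq_bigr => k _; rewrite modn_small // ltnS.
  by rewrite (leq_trans (ltn_ord k)).
rewrite zp_prod expr_sum; apply: eq_bigr => k _.
by rewrite !gcE zpM.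
Qed.

(** The correction for [ord_max] encodes g_n = g_1^-1 ... g_{n-1}^-1; it does not depend on [j], so
    it drops out of [wt]. *)
Lemma G_gen i j : G (gen_g l i) j = (j == i)%:R - (i == ord_max)%:R.
Proof.
have [nj|jn] := leqP n.-1 j.
  have -> : j = ord_max by apply/val_inj/anti_leq; rewrite /= nj -ltnS ltn_ord.
  by rewrite G_ge //= eq_sym subrr.
rewrite G_lt ffunE -![_ == _ :> 'I_n]val_eqE /=.
case: eqP => [->|_]; first by rewrite ltn_eqF // sub0r.
by rewrite subr0; case: eqP.
Qed.

Lemma wt_gen i j : wt (gen_g l i) j = (j == i)%:R - (j == ordS i)%:R.
Proof.
rewrite /wt !G_gen opprB addrA subrK; congr (_ - (nat_of_bool _)%:R).
by rewrite [RHS]eq_sym ordS_eq eq_sym.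
Qed.

(** Both sides are [G h (ordS i) - G h (ord_pred i)]: the constant in [G_gen] contributes the same
    multiple of the coordinate sum of [h] to both pairings. Up to sign this is the exponent for
    exchanging g_i and h in the twisted group algebra. *)
Lemma pairing_gen i h :
  pairing (gen_g l i) h - pairing h (gen_g l i) = wt h i + wt h (ordS i).
Proof.
have -> : pairing (gen_g l i) h
    = G h (ordS i) - (i == ord_max)%:R * \sum_(j : 'I_n) G h (ordS j).
  rewrite /pairing mulr_sumr (eq_bigr (fun j : 'I_n => (j == i)%:R * G h (ordS j)
     - (i == ord_max)%:R * G h (ordS j))) => [|j _]; last by rewrite G_gen mulrBl.
  rewrite sumrB (bigD1 i) //= eqxx mul1r big1 ?addr0 // => j /negPf->.
  by rewrite mul0r.
have -> : pairing h (gen_g l i)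
    = G h (ord_pred i) - (i == ord_max)%:R * \sum_(j : 'I_n) G h j.
  rewrite /pairing mulr_sumr (eq_bigr (fun j : 'I_n => (j == ord_pred i)%:R * G h j
     - (i == ord_max)%:R * G h j)) => [|j _].
    rewrite sumrB (bigD1 (ord_pred i)) //= eqxx mul1r big1 ?addr0 // => j /negPf->.
    by rewrite mul0r.
  by rewrite G_gen mulrC mulrBl -ordS_eq.
rewrite (sum_ordS (fun j => G h j)) /wt ordSK.
by rewrite opprB [RHS]addrC !addrA !addrNK.
Qed.

End GroupExponents.

(** * The embedding into the quantum torus *)

Section QuantumTorus.
Variables (C : fieldType) (m l : nat) (zeta : C) (t : 'I_m.+3 -> C).
Hypotheses (l_gt1 : (1 < l)%N) (zeta_prim : l.-primitive_root zeta).
Local Notation n := m.+3.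
Local Notation grp := {ffun 'I_n.-1 -> 'Z_l}.
Local Notation K := ({ffun 'I_n -> int} * grp)%type.
Local Notation zp := (zp zeta).
Local Notation zpD := (zpD l_gt1 zeta_prim).
Local Notation zpN := (zpN l_gt1 zeta_prim).
Local Notation zp0 := (zp0 l zeta).
Implicit Types (g h : grp) (i j : 'I_n) (k : K).

(** Normal order is x^q g: the sum comes from moving the first group part past the second Laurent
    monomial, the pairing from [alpha]. *)
Definition wexp k k' : 'Z_l :=
  \sum_j wt k.2 j *~ k'.1 j - pairing k.2 k'.2.

Lemma wexpDl k1 k2 k : wexp (k1 + k2) k = wexp k1 k + wexp k2 k.
Proof.
rewrite /wexp pairingDl opprD addrACA -big_split; congr (_ + _).
by apply: eq_bigr => j _; rewrite wtD mulrzDl.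
Qed.

Lemma wexpDr k k1 k2 : wexp k (k1 + k2) = wexp k k1 + wexp k k2.
Proof.
rewrite /wexp pairingDr opprD addrACA -big_split; congr (_ + _).
by apply: eq_bigr => j _; rewrite ffunE mulrzDr.
Qed.

Lemma wexp_group1l k q : wexp (q, 0) k = 0.
Proof.
by rewrite /wexp pairing0l subr0 big1 // => j _; rewrite wt0 mul0rz.
Qed.

Lemma wexp0r k : wexp k 0 = 0.
Proof.
by rewrite /wexp pairing0r subr0 big1 // => j _; rewrite ffunE mulr0z.
Qed.

(** An opaque existence statement, so that later computations see the bicharacter only through the
    formula for its values. *)
Lemma torus_bichar_subproof :
  {b : bicharacter K C | forall k k', b k k' = zp (wexp k k')}.
Proof.
pose b k k' := zp (wexp k k').
have bDl k1 k2 k : b (k1 + k2) k = b k1 k * b k2 k by rewrite /b wexpDl zpD.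
have bDr k k1 k2 : b k (k1 + k2) = b k k1 * b k k2 by rewrite /b wexpDr zpD.
have b0l k : b 0 k = 1 by rewrite /b wexp_group1l zp0.
have b0r k : b k 0 = 1 by rewrite /b wexp0r zp0.
by exists (Bicharacter bDl bDr b0l b0r).
Qed.

Definition torus_bichar : bicharacter K C := sval torus_bichar_subproof.

Lemma torus_bicharE k k' : torus_bichar k k' = zp (wexp k k').
Proof. exact: (svalP torus_bichar_subproof). Qed.

Variable S : twisted_algebra torus_bichar.
Local Notation mon := (@twmon _ _ torus_bichar S).

Lemma monM k k' : mon k * mon k' = zp (wexp k k') *: mon (k + k').
Proof. by rewrite twmonM torus_bicharE. Qed.

Lemma mon_comm k k' :
  mon k * mon k' = zp (wexp k k' - wexp k' k) *: (mon k' * mon k).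
Proof. by rewrite !monM scalerA -zpD subrK addrC. Qed.

Definition ev i : {ffun 'I_n -> int} := [ffun j => (j == i)%:R].

Lemma sum_ev (F : 'I_n -> 'Z_l) i : \sum_j F j *~ ev i j = F i.
Proof.
rewrite (bigD1 i) //= ffunE eqxx big1 ?addr0 // => j /negPf ji.
by rewrite ffunE ji.
Qed.

Lemma sum_wt_gen i (q : {ffun 'I_n -> int}) :
  \sum_j wt (gen_g l i) j *~ q j = (q i)%:~R - (q (ordS i))%:~R.
Proof.
rewrite (eq_bigr (fun j => (q j)%:~R *~ ev i j - (q j)%:~R *~ ev (ordS i) j)).
  by rewrite sumrB !sum_ev.
move=> j _; rewrite wt_gen !ffunE.
by case: (j == i); case: (j == ordS i) => /=; ring.
Qed.

Definition tx i : S := mon (ev i, 0).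

Definition tv i : S :=
  (t i / (zeta^-1 - 1)) *: mon (- ev (ordS i), gen_g l i).

Definition tg g : S := mon (0, g).

Definition tX i : S := tx i + tv i.

Lemma tx_comm i k : tx i * mon k = zp (- wt k.2 i) *: (mon k * tx i).
Proof.
rewrite /tx mon_comm wexp_group1l sub0r /wexp /=.
by rewrite (sum_ev (wt k.2)) pairing0r subr0.
Qed.

(** The weight at [ordS i] produced by x_{i+1}^-1 cancels the one in [pairing_gen]; hence v_i passes
    a group element with the same scalar as x_i, and [tX i] is still a weight vector. *)
Lemma tv_comm i k :
  tv i * mon k = zp ((k.1 i)%:~R - (k.1 (ordS i))%:~R - wt k.2 i) *: (mon k * tv i).
Proof.
rewrite /tv -scalerAl mon_comm -scalerAr !scalerA [_ * zp _]mulrC.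
congr (_ *: _). congr (_ * _). congr (zp _). rewrite /wexp. rewrite /=.
have -> : \sum_j wt k.2 j *~ (- ev (ordS i)) j = - wt k.2 (ordS i).
  rewrite -[in RHS](sum_ev (wt k.2)) -sumrN; apply: eq_bigr => j _.
  by rewrite [in LHS]ffunE mulrNz.
rewrite sum_wt_gen.
have := pairing_gen i k.2; move/eqP; rewrite subr_eq => /eqP ->.
ring.
Qed.

Lemma tx_tx i j : GRing.comm (tx i) (tx j).
Proof. by rewrite /GRing.comm tx_comm wt0 oppr0 zp0 scale1r. Qed.

Lemma tv_tv i j : GRing.comm (tv i) (tv j).
Proof.
rewrite /GRing.comm [tv j]/tv -scalerAr tv_comm /= wt_gen !ffunE.
rewrite (inj_eq (@ordS_inj _)) !rmorphN !rmorph_nat opprK.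
by rewrite (_ : _ + _ - _ = 0) ?zp0 ?scale1r ?scalerAl //; ring.
Qed.

Lemma tx_tv i j :
  tx i * tv j = zp ((i == ordS j)%:R - (i == j)%:R : 'Z_l) *: (tv j * tx i).
Proof.
rewrite /tv -scalerAr tx_comm /= wt_gen opprB -scalerAl !scalerA.
by rewrite mulrC.
Qed.

Lemma tx_tv_comm i j : i != j -> i != ordS j -> GRing.comm (tx i) (tv j).
Proof.
move=> /negPf ij /negPf iSj; rewrite /GRing.comm tx_tv ij iSj.
by rewrite subrr zp0 scale1r.
Qed.

Lemma txS_tv j :
  tx (ordS j) * tv j = (t j / (zeta^-1 - 1)) *: tg (gen_g l j).
Proof.
rewrite /tx /tv -scalerAr monM wexp_group1l zp0 scale1r.
by congr (_ *: mon (_, _)); [exact: subrr | exact: add0r].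
Qed.

Lemma tv_txS j :
  tv j * tx (ordS j) = (zeta^-1 * (t j / (zeta^-1 - 1))) *: tg (gen_g l j).
Proof.
rewrite -scalerA -txS_tv tx_tv eqxx (negPf (ordS_neq j)) subr0 scalerA.
by rewrite (zp1 l_gt1 zeta_prim) mulVf ?scale1r // (zeta_neq0 l_gt1 zeta_prim).
Qed.

Lemma tgM (g h : Defs.grp n l) : tg g * tg h = alpha zeta g h *: tg (gmul g h).
Proof.
rewrite /tg monM (alphaE l_gt1 zeta_prim) /wexp /= big1 ?add0r => [|j _].
  have -> : gmul g h = (g : grp) + (h : grp).
    by apply/ffunP => j; rewrite !ffunE.
  by congr (_ *: mon (_, _)); exact: add0r.
by rewrite ffunE mulr0z.
Qed.

Lemma tg0 : tg 0 = 1.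
Proof. exact: twmon0. Qed.

Lemma tg_tX (g : Defs.grp n l) i : tg g * tX i = act zeta g i *: (tX i * tg g).
Proof.
rewrite (actE l_gt1 zeta_prim) mulrDl tx_comm tv_comm /= !ffunE subrr sub0r.
by rewrite -scalerDr scalerA -zpD subrr zp0 scale1r mulrDr.
Qed.

(** The x commute, the v commute, and x_i commutes with v_{i+1}; there remains v_i x_{i+1} - x_{i+1}
    v_i = (zeta^-1 - 1) x_{i+1} v_i, which the denominator in [tv] normalises to t_i g_i. *)
Lemma tX_adjacent i :
  tX i * tX (ordS i) - tX (ordS i) * tX i = t i *: tg (gen_g l i).
Proof.
have zV1 : zeta^-1 - 1 != 0.
  by rewrite subr_eq0 invr_eq1 (zeta_neq1 l_gt1 zeta_prim).
rewrite !mulrDl !mulrDr (tx_tx i) (tv_tv i) txS_tv tv_txS.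
rewrite (tx_tv_comm (i := i) (j := ordS i)) 1?eq_sym ?ordS_neq ?ordSS_neq //.
rewrite [X in _ - X]addrACA opprD addrACA subrr add0r opprD addrACA subrr addr0.
by rewrite -scalerBl -{2}[t i / _]mul1r -mulrBl mulrC divfK.
Qed.

Lemma tX_nonadj i j : nonadj i j -> GRing.comm (tX i) (tX j).
Proof.
rewrite nonadjE => /andP[jSi iSj]; have [->//|ij] := eqVneq i j.
apply: commrD; apply/commr_sym; apply: commrD; apply/commr_sym.
- exact: tx_tx.
- by apply/commr_sym/tx_tv_comm => //; rewrite eq_sym.
- exact: tx_tv_comm.
- exact: tv_tv.
Qed.

Definition phib (b : basis n l) : S := (\prod_(i <- b.1) tX i) * tg b.2.

Definition phi (f : elt C n l) : S := \sum_(p <- f) p.1 *: phib p.2.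

Lemma phi_cat (f f' : elt C n l) : phi (f ++ f') = phi f + phi f'.
Proof. by rewrite /phi big_cat. Qed.

Lemma phi_scale a (f : elt C n l) : phi (escale a f) = a *: phi f.
Proof.
by rewrite /phi big_map scaler_sumr; apply: eq_bigr => p _; rewrite scalerA.
Qed.

Lemma phi_sub (f f' : elt C n l) : phi (esub f f') = phi f - phi f'.
Proof. by rewrite phi_cat phi_scale scaleN1r. Qed.

Lemma phi_flatten (I : Type) (s : seq I) (F : I -> elt C n l) :
  phi (flatten [seq F y | y <- s]) = \sum_(y <- s) phi (F y).
Proof.
elim: s => [|y s IHs]; first by rewrite /phi !big_nil.
by rewrite /= phi_cat IHs big_cons.
Qed.

Lemma tg_word (g : Defs.grp n l) (s : seq 'I_n) :
  tg g * (\prod_(i <- s) tX i) = actw zeta g s *: ((\prod_(i <- s) tX i) * tg g).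
Proof.
elim: s => [|i s IHs]; first by rewrite /actw !big_nil scale1r mulr1 mul1r.
rewrite /actw !big_cons mulrA tg_tX -scalerAl -[tX i * tg g * _]mulrA IHs.
by rewrite -scalerAr scalerA -[in RHS]mulrA.
Qed.

Lemma phib_mul (b b' : basis n l) :
  phib b * phib b' = (mulb zeta b b').1 *: phib (mulb zeta b b').2.
Proof.
rewrite /phib /= big_cat /= mulrA -[_ * tg b.2 * _]mulrA tg_word.
rewrite -scalerAr -scalerAl !mulrA -[_ * tg b.2 * tg _]mulrA tgM.
by rewrite -scalerAr scalerA [actw _ _ _ * _]mulrC.
Qed.

Lemma phi_mul (f f' : elt C n l) : phi (emul zeta f f') = phi f * phi f'.
Proof.
rewrite /phi /emul big_allpairs_dep mulr_suml; apply: eq_bigr => p _.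
rewrite mulr_sumr; apply: eq_bigr => q _.
by rewrite -scalerAl -scalerAr phib_mul !scalerA.
Qed.

Lemma big_coefE (V : lmodType C) (F : basis n l -> V) (r : seq (basis n l))
    (f : elt C n l) : uniq r -> (forall p, p \in f -> p.2 \in r) ->
  \sum_(p <- f) p.1 *: F p.2 = \sum_(b <- r) coef f b *: F b.
Proof.
move=> Ur fr; rewrite /coef.
under [RHS]eq_bigr do rewrite scaler_suml big_mkcond /=.
rewrite exchange_big /= big_seq [RHS]big_seq; apply: eq_bigr => p /fr pr.
rewrite (bigD1_seq p.2) //= eqxx big1_seq ?addr0 // => b /andP[/negPf pb _].
by rewrite eq_sym pb.
Qed.

(** Lists with equal coefficient functions may differ in order, repetitions and cancelling terms, so
    both images are regrouped over one duplicate-free list of basis elements. *)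
Lemma phi_coef (f f' : elt C n l) : coef f =1 coef f' -> phi f = phi f'.
Proof.
move=> ff'; pose r := undup [seq p.2 | p <- f ++ f'].
have sub_r (p : C * basis n l) : p \in f ++ f' -> p.2 \in r.
  by move=> pf; rewrite mem_undup map_f.
rewrite /phi !(@big_coefE _ _ r) ?undup_uniq // => [|p pf|p pf].
- by apply: eq_bigr => b _; rewrite ff'.
- by apply: sub_r; rewrite mem_cat pf orbT.
- by apply: sub_r; rewrite mem_cat pf.
Qed.

Lemma phi_ex i : phi (ex C l i) = tX i.
Proof. by rewrite /phi /ex big_seq1 scale1r /phib big_seq1 /= tg0 mulr1. Qed.

Lemma phi_eg (g : Defs.grp n l) : phi (eg C g) = tg g.
Proof. by rewrite /phi big_seq1 scale1r /phib big_nil mul1r. Qed.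

Lemma phi_one : phi (eone C n l) = 1.
Proof. by rewrite phi_eg; exact: tg0. Qed.

Lemma phi_rel (r : elt C n l) : is_rel zeta t r -> phi r = 0.
Proof.
case=> [[i ->]|[i [j [ij ->]]]]; rewrite !phi_sub !phi_mul !phi_ex.
  by rewrite phi_scale phi_eg tX_adjacent subrr.
by rewrite (tX_nonadj ij) subrr.
Qed.

Lemma phi_eqH (f f' : elt C n l) : eqH zeta t f f' -> phi f = phi f'.
Proof.
case=> s [rel_s coef_s]; apply/eqP; rewrite -subr_eq0 -phi_sub; apply/eqP.
rewrite (phi_coef coef_s) phi_flatten big_seq big1 // => q /rel_s q_rel.
by rewrite phi_scale !phi_mul (phi_rel q_rel) mulr0 mul0r scaler0.
Qed.

End QuantumTorus.

(** * Central elements *)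

Lemma prod_seq_eq0 (R : nzRingType) (I : eqType) (r : seq I) (F : I -> R) i :
  i \in r -> F i = 0 -> \prod_(j <- r) F j = 0.
Proof.
move=> + Fi; elim: r => // j r IHr; rewrite inE big_cons => /orP[/eqP<-|/IHr->].
  by rewrite Fi mul0r.
by rewrite mulr0.
Qed.

Lemma prodr_enum (R : nzRingType) (T : finType) (A : {pred T}) (F : T -> R) :
  \prod_(i <- enum A) F i = \prod_(i in A) F i.
Proof. by rewrite -[RHS]big_filter [index_enum T]unlock. Qed.

Lemma prod_inord (R : nzRingType) N (F : 'I_N.+1 -> R) :
  \prod_(0 <= j < N.+1) F (inord j) = \prod_i F i.
Proof. by rewrite big_mkord; apply: eq_bigr => i _; rewrite inord_val. Qed.

Section CentralElements.
Variables (C : fieldType) (m l : nat) (zeta : C) (t : 'I_m.+3 -> C).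
Hypotheses (l_gt1 : (1 < l)%N) (zeta_prim : l.-primitive_root zeta).
Local Notation n := m.+3.
Variable S : twisted_algebra (torus_bichar m l_gt1 zeta_prim).
Local Notation mon := (@twmon _ _ _ S).
Local Notation tx := (tx S).
Local Notation tv := (tv t S).
Local Notation tX := (tX t S).
Local Notation tg := (tg S).
Local Notation phi := (phi t S).
Local Notation tau := (tau zeta t).
Implicit Types (i j : 'I_n) (A : {set 'I_n}).

Lemma phi_gprod A : phi (gprod l zeta A) = \prod_(i in A) tg (gen_g l i).
Proof.
rewrite -prodr_enum /gprod; elim: (enum A) => [|i s IHs] /=.
  by rewrite phi_one big_nil.
by rewrite phi_mul IHs phi_eg big_cons.
Qed.

Lemma phi_xmon A : phi (xmon C l A) = \prod_i tX i ^+ pexp A i.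
Proof.
rewrite /phi big_seq1 scale1r /phib /= tg0 mulr1 big_flatten big_map prodr_enum.
apply: eq_bigr => i _; elim: (pexp A i) => [|k IHk]; first by rewrite big_nil.
by rewrite /= big_cons IHk exprS.
Qed.

(** A dimer covering i and i+1 is recorded at i, and site i+1 then contributes 1. The factor 0 kills
    overlapping dimers, so the sum defining [w] extends from [Jset] to all subsets. *)
Definition tile A i : S :=
  if i \in A then (if ord_pred i \in A then 0 else tau i *: tg (gen_g l i))
  else if ord_pred i \in A then 1 else tX i.

Lemma tile_prod_notin A : A \notin Jset n -> \prod_i tile A i = 0.
Proof.
have tileS i : i \in A -> ordS i \in A -> \prod_i tile A i = 0.
  move=> iA SiA; apply: (@prod_seq_eq0 _ _ _ _ (ordS i)).
    by rewrite mem_index_enum.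
  by rewrite /tile SiA ordSK iA.
rewrite inE => /forall_inPn[i iA /forall_inPn[j jA]].
rewrite nonadjE negb_and !negbK => /orP[] /eqP e.
  by apply: (tileS i); rewrite // -e.
by apply: (tileS j); rewrite // -e.
Qed.

(** The product interleaves the [tX] with group elements. An uncovered site differs from i and i+1
    for every i in [A], so its [tX] has weight 0 under g_i and moves to the left past it. *)
Lemma tile_prod A : A \in Jset n ->
  \prod_i tile A i =
  (\prod_(i in A) tau i) *: (phi (xmon C l A) * phi (gprod l zeta A)).
Proof.
rewrite inE => /forall_inP AJ.
have AS i : i \in A -> ord_pred i \in A -> false.
  move=> iA piA; have /forall_inP/(_ _ iA) := AJ _ piA.
  by rewrite nonadjE ord_predK eqxx.
rewrite phi_xmon phi_gprod !(big_mkcond (mem A)) -!prod_inord.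
suff H k : \prod_(0 <= j < k) tile A (inord j)
    = (\prod_(0 <= j < k) (if inord j \in A then tau (inord j) else 1)) *:
      ((\prod_(0 <= j < k) tX (inord j) ^+ pexp A (inord j)) *
       \prod_(0 <= j < k) (if inord j \in A then tg (gen_g l (inord j)) else 1)).
  exact: H.
elim: k => [|k IHk]; first by rewrite !big_nil mulr1 scale1r.
rewrite !big_nat_recr //= IHk -scalerAl -!scalerA; congr (_ *: _).
move: (inord k : 'I_n) => i; rewrite /tile /pexp.
set P := \prod_(0 <= _ < k) _; set Q := \prod_(0 <= _ < k) _.
case iA: (i \in A); case piA: (ord_pred i \in A) => /=.
- by have := AS _ iA piA.
- by rewrite expr0 mulr1 -!scalerAr mulrA.
- by rewrite expr0 !mulr1 scale1r.
rewrite expr1 mulr1 scale1r -!mulrA; congr (_ * _); symmetry.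
rewrite /Q; apply: commr_prod => j _; case: ifP => [jA|_]; last exact: commr1.
apply/commr_sym; rewrite /GRing.comm tg_tX actE // wt_gen.
have /negPf-> : i != inord j by apply: contraFneq iA => ->.
have /negPf-> : i != ordS (inord j).
  by apply: contraFneq piA => ->; rewrite ordSK.
by rewrite subrr zp0 scale1r.
Qed.

Lemma phi_w : phi (w l zeta t) = \prod_i tx i + \prod_i tv i.
Proof.
rewrite phi_flatten big_enum /=.
under eq_bigr => A AJ do rewrite phi_scale phi_mul -tile_prod //.
rewrite big_mkcond /= (eq_bigr (fun A => \prod_i tile A i)); last first.
  by move=> A _; case: ifP => // /negbT /tile_prod_notin ->.
have inordS k : (k < m.+2)%N -> inord k.+1 = ordS (inord k) :> 'I_n.
  move=> kn; apply/val_inj; rewrite val_ordS /= !inordK ?ltnS //; last exact: ltnW.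
  by rewrite ltn_eqF.
have inordN : ordS (inord m.+2) = inord 0 :> 'I_n.
  by apply/val_inj; rewrite val_ordS /= !inordK // eqxx.
have zV1 : zeta^-1 - 1 != 0.
  by rewrite subr_eq0 invr_eq1 (zeta_neq1 l_gt1 zeta_prim).
have z1 : zeta - 1 != 0 by rewrite subr_eq0 (zeta_neq1 l_gt1 zeta_prim).
have z1' : 1 + -1 * zeta != 0.
  by rewrite mulN1r subr_eq0 eq_sym (zeta_neq1 l_gt1 zeta_prim).
have z0 := zeta_neq0 l_gt1 zeta_prim.
have inord_eq (a b : nat) : (a < n)%N -> (b < n)%N ->
    (inord a == inord b :> 'I_n) = (a == b).
  by move=> an bn; rewrite -val_eqE /= !inordK.
have := @dimer_sum S (fun k => tx (inord k)) (fun k => tv (inord k))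
  (fun k => tau (inord k) *: tg (gen_g l (inord k))) m.+2 isT.
rewrite !prod_inord => <-; first last.
- move=> k /andP[k0 kN]; have kn : (k < n)%N by apply: ltnW.
  apply: tx_tv_comm; last by rewrite -inordS // inord_eq.
  by rewrite inord_eq // eq_sym -lt0n.
- by move=> k _; exact: tx_tx.
(* The closing relation has the order x_1 v_n, without the factor zeta^-1 of [tv_txS]; the extra
   zeta in tau_n accounts for this. *)
- rewrite -inordN txS_tv -scaleNr /Defs.tau /= inordK // eqxx.
  by congr (_ *: _); field; rewrite z0 z1' z1.
- move=> k kN; have kn : (k < n)%N by apply: ltnW.
  rewrite inordS // tv_txS -scaleNr /Defs.tau /= inordK //.
  rewrite ltn_eqF //.
  by congr (_ *: _); field; rewrite z0 z1' z1.
apply: eq_bigr => A _; rewrite -prod_inord; apply: eq_big_nat => k /andP[_ kn].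
rewrite /tile /dimer /prev_in.
suff -> : (if k is k'.+1 then inord k' \in A else ord_max \in A)
          = (ord_pred (inord k) \in A) by [].
case: k kn => [|k] kn; congr (_ \in A).
  apply: (can_inj (@ordSK _)); rewrite ord_predK -inordN; congr ordS.
  by apply/val_inj; rewrite /= inordK.
by rewrite inordS // ordSK.
Qed.

Lemma prod_tx_comm (r : seq 'I_n) k : \prod_(i <- r) tx i * mon k
  = zp zeta (\sum_(i <- r) - wt k.2 i) *: (mon k * \prod_(i <- r) tx i).
Proof.
elim: r => [|i r IHr]; first by rewrite !big_nil zp0 scale1r mulr1 mul1r.
rewrite !big_cons -mulrA IHr -scalerAr [tx i * (_ * _)]mulrA tx_comm.
by rewrite -scalerAl scalerA -zpD // addrC [in RHS]mulrA.
Qed.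

Lemma prod_tv_comm (r : seq 'I_n) k : \prod_(i <- r) tv i * mon k
  = zp zeta (\sum_(i <- r) ((k.1 i)%:~R - (k.1 (ordS i))%:~R - wt k.2 i))
    *: (mon k * \prod_(i <- r) tv i).
Proof.
elim: r => [|i r IHr]; first by rewrite !big_nil zp0 scale1r mulr1 mul1r.
rewrite !big_cons -mulrA IHr -scalerAr [tv i * (_ * _)]mulrA tv_comm.
by rewrite -scalerAl scalerA -zpD // addrC [in RHS]mulrA.
Qed.

(** Past a basis monomial, the product of the x picks up minus the total weight of its group part,
    and the product of the v in addition the cyclic sum of k_i - k_{i+1}; both exponents are 0. *)
Lemma phi_w_comm f : GRing.comm (phi (w l zeta t)) f.
Proof.
apply: twmon_central => k; rewrite phi_w; apply/commr_sym/commrD; apply/commr_sym.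
  by rewrite /GRing.comm prod_tx_comm sumrN sum_wt oppr0 zp0 scale1r.
rewrite /GRing.comm prod_tv_comm 2!sumrB sum_wt subr0.
by rewrite (sum_ordS (fun i => (k.1 i)%:~R)) subrr zp0 scale1r.
Qed.

(** For adjacent indices the commutator is a multiple of a group generator that q-commutes with
    [tX i], where q is zeta or zeta^-1; then 1 + q + ... + q^(l-1) = 0. *)
Lemma tX_exp_comm_tX i j : GRing.comm (tX i ^+ l) (tX j).
Proof.
have qcomm q c : q != 1 -> q ^+ l = 1 -> tX i * tX j - tX j * tX i = c ->
    c * tX i = q *: (tX i * c) -> GRing.comm (tX i ^+ l) (tX j).
  move=> q1 ql ijc cq; apply/eqP; rewrite -subr_eq0 (qcommutator_exp ijc cq).
  have /eqP : (q - 1) * (\sum_(k < l) q ^+ k) = 0 by rewrite -subrX1 ql subrr.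
  by rewrite mulf_eq0 subr_eq0 (negPf q1) /= => /eqP->; rewrite scale0r.
have z1 := zeta_neq1 l_gt1 zeta_prim.
have [ij|] := boolP (nonadj i j).
  by apply/commr_sym/commrX/tX_nonadj; rewrite nonadjE andbC -nonadjE.
rewrite nonadjE negb_and !negbK => /orP[] /eqP e.
  apply: (@qcomm zeta (t i *: tg (gen_g l i))) => //.
  - exact: prim_expr_order.
  - by rewrite e tX_adjacent.
  rewrite -scalerAl tg_tX actE // wt_gen eqxx eq_sym (negPf (ordS_neq i)) subr0.
  by rewrite zp1 // -scalerAr !scalerA mulrC.
apply: (@qcomm zeta^-1 (- (t j *: tg (gen_g l j)))).
- by rewrite invr_eq1.
- by rewrite exprVn prim_expr_order ?invr1.
- by rewrite e -tX_adjacent opprB.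
rewrite mulNr mulrN scalerN -scalerAl tg_tX actE // wt_gen e eqxx.
rewrite (negPf (ordS_neq j)) sub0r zpN // zp1 //.
by rewrite -scalerAr !scalerA mulrC.
Qed.

Lemma tX_exp_comm_tg i (g : grp n l) : GRing.comm (tX i ^+ l) (tg g).
Proof.
have H k : tg g * tX i ^+ k = act zeta g i ^+ k *: (tX i ^+ k * tg g).
  elim: k => [|k IHk]; first by rewrite !expr0 scale1r mulr1 mul1r.
  rewrite exprS mulrA tg_tX -scalerAl -[tX i * tg g * _]mulrA IHk -scalerAr.
  by rewrite scalerA exprS mulrA.
apply/esym; rewrite H actE // /zp exprAC (prim_expr_order zeta_prim).
by rewrite expr1n scale1r.
Qed.

Lemma phi_gens_Some i : phi (gens l zeta t (Some i)) = tX i ^+ l.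
Proof.
(* [l] also occurs in the types, so the induction runs over a separate number of iterations. *)
suff H k : phi (iter k (emul zeta (ex C l i)) (eone C n l)) = tX i ^+ k by exact: H.
elim: k => [|k IHk]; first by rewrite phi_one.
by rewrite iterS phi_mul phi_ex IHk exprS.
Qed.

Lemma phi_gens_comm o (f : elt C n l) :
  GRing.comm (phi (gens l zeta t o)) (phi f).
Proof.
case: o => [i|]; last exact: phi_w_comm.
rewrite phi_gens_Some; apply: commr_sum => p _.
rewrite /GRing.comm -scalerAr -scalerAl; congr (_ *: _).
apply: commrM; last exact: tX_exp_comm_tg.
by apply: commr_prod => j _; apply: tX_exp_comm_tX.
Qed.

Lemma phi_emonom s :
  phi (emonom l zeta t s) = \prod_(o <- s) phi (gens l zeta t o).
Proof.
elim: s => [|o s IHs]; first by rewrite phi_one big_nil.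
by rewrite /= phi_mul IHs big_cons.
Qed.

End CentralElements.

(** * Straightening *)

Section Straightening.
Variables (C : fieldType) (m l : nat) (zeta : C) (t : 'I_m.+3 -> C).
Hypotheses (l_gt1 : (1 < l)%N) (zeta_prim : l.-primitive_root zeta).
Local Notation n := m.+3.
Local Notation elt := (elt C n l).
Local Notation basis := (basis n l).
Local Notation grp := (grp n l).
Local Notation eqH := (eqH zeta t).
Implicit Types (f : elt) (s u v : seq 'I_n) (g : grp) (i j : 'I_n).

Lemma coef_cat f f' b : coef (f ++ f') b = coef f b + coef f' b.
Proof. by rewrite /coef big_cat. Qed.

Lemma coef_scale a f b : coef (escale a f) b = a * coef f b.
Proof. by rewrite /coef big_map mulr_sumr. Qed.

Lemma coef_nil b : coef ([::] : elt) b = 0.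
Proof. by rewrite /coef big_nil. Qed.

Lemma coef_cons a b' f b : coef ((a, b') :: f) b = a * (b' == b)%:R + coef f b.
Proof. by rewrite /coef big_cons /=; case: eqP; rewrite ?mulr1 // mulr0 add0r. Qed.

Lemma in_ideal_coef f f' :
  coef f =1 coef f' -> in_ideal zeta t f -> in_ideal zeta t f'.
Proof. by move=> ff' [s [rs fs]]; exists s; split=> // b; rewrite -ff' fs. Qed.

Lemma in_ideal_cat f f' :
  in_ideal zeta t f -> in_ideal zeta t f' -> in_ideal zeta t (f ++ f').
Proof.
move=> [s [rs fs]] [s' [rs' fs']]; exists (s ++ s'); split=> [q|b].
  by rewrite mem_cat => /orP[/rs|/rs'].
by rewrite map_cat flatten_cat !coef_cat fs fs'.
Qed.

Lemma in_ideal_scale a f : in_ideal zeta t f -> in_ideal zeta t (escale a f).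
Proof.
move=> [s [rs fs]]; exists [seq (a * q.1.1.1, q.1.1.2, q.1.2, q.2) | q <- s].
split=> [q /mapP[q' /rs rq' ->] //|b].
rewrite coef_scale fs {rs fs}; elim: s => [|q s IHs]; first by rewrite coef_nil mulr0.
by rewrite /= !coef_cat mulrDr IHs !coef_scale mulrA.
Qed.

Lemma eqH_coef f f' : coef f =1 coef f' -> eqH f f'.
Proof.
move=> ff'; exists [::]; split=> // b.
by rewrite coef_cat coef_scale ff' mulN1r subrr coef_nil.
Qed.

Lemma eqH_trans f' f f'' : eqH f f' -> eqH f' f'' -> eqH f f''.
Proof.
move=> ff' /(in_ideal_cat ff'); apply: in_ideal_coef => b.
by rewrite !coef_cat !coef_scale !mulN1r addrA addrNK.
Qed.

Lemma eqH_cat f1 f1' f2 f2' :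
  eqH f1 f1' -> eqH f2 f2' -> eqH (f1 ++ f2) (f1' ++ f2').
Proof.
move=> e1 /(in_ideal_cat e1); apply: in_ideal_coef => b.
by rewrite !coef_cat !coef_scale !coef_cat !mulN1r addrACA opprD.
Qed.

Lemma eqH_scale a f f' : eqH f f' -> eqH (escale a f) (escale a f').
Proof.
move=> /(in_ideal_scale a); apply: in_ideal_coef => b.
by rewrite !(coef_cat, coef_scale) mulrDr mulrCA.
Qed.

Lemma alpha1l g : alpha zeta (gone n l) g = 1.
Proof. by rewrite (alphaE l_gt1 zeta_prim) pairing0l oppr0 zp0. Qed.

Lemma actw1 s : actw zeta (gone n l) s = 1.
Proof.
rewrite /actw big1 // => j _; rewrite (actE l_gt1 zeta_prim).
by rewrite (wt0 l j) zp0.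
Qed.

Lemma gmul1l g : gmul (gone n l) g = g.
Proof. by apply/ffunP => k; rewrite !ffunE add0r. Qed.

Lemma emul_ex i j : emul zeta (ex C l i) (ex C l j) = ebas C ([:: i; j], gone n l).
Proof. by rewrite /emul /= !(alpha1l, actw1, gmul1l, mulr1). Qed.

Lemma emul_ebasl b f : emul zeta (ebas C b) f
  = [seq (1 * q.1 * (mulb zeta b q.2).1, (mulb zeta b q.2).2) | q <- f].
Proof. by rewrite /emul /= cats0. Qed.

Lemma emul_ebasr b f : emul zeta f (ebas C b)
  = [seq (p.1 * 1 * (mulb zeta p.2 b).1, (mulb zeta p.2 b).2) | p <- f].
Proof. by elim: f => //= p f <-. Qed.

Lemma eqH_rel (r : elt) u v g : is_rel zeta t r -> 
  in_ideal zeta t [seq (p.1 * (mulb zeta p.2 (v, g)).1,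
     (u ++ (mulb zeta p.2 (v, g)).2.1, (mulb zeta p.2 (v, g)).2.2)) | p <- r].
Proof.
move=> rel_r; exists [:: (1, (u, gone n l), r, (v, g))].
split=> [q|b]; first by rewrite inE => /eqP->.
rewrite /= cats0 coef_scale mul1r; congr (coef _ b).
rewrite emul_ebasl emul_ebasr -map_comp.
apply: eq_map => p; rewrite /= alpha1l actw1 gmul1l !mulr1 !mul1r.
by rewrite catA.
Qed.

Definition bounded d f := all (fun p => (size p.2.1 < d)%N) f.

Lemma bounded_cat d f f' : bounded d (f ++ f') = bounded d f && bounded d f'.
Proof. exact: all_cat. Qed.

Lemma bounded_scale d a f : bounded d (escale a f) = bounded d f.
Proof. exact: all_map. Qed.

(** The commutator of two letters is 0 or a multiple of a group element, which is moved right past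
    [v]; the correction has two letters fewer. *)
Lemma word_swap u v i j g : exists2 f, bounded (size u + size v).+1 f &
  eqH (ebas C (u ++ [:: i, j & v], g)) (ebas C (u ++ [:: j, i & v], g) ++ f).
Proof.
pose f0 i' := [:: (t i' * (mulb zeta ([::], gen_g l i') (v, g)).1,
  (u ++ v, gmul (gen_g l i') g))] : elt.
have bf0 i' : bounded (size u + size v).+1 (f0 i').
  by rewrite /bounded /= size_cat ltnSn.
have adj i' : eqH (ebas C (u ++ [:: i', ordS i' & v], g))
    (ebas C (u ++ [:: ordS i', i' & v], g) ++ f0 i').
  have rel_i : is_rel zeta t (esub (esub (emul zeta (ex C l i') (ex C l (ordS i')))
      (emul zeta (ex C l (ordS i')) (ex C l i'))) (escale (t i') (eg C (gen_g l i')))).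
    by left; exists i'.
  apply: in_ideal_coef (eqH_rel u v g rel_i) => b.
  rewrite !emul_ex /= !(alpha1l, actw1, gmul1l, mulr1, mulN1r).
  by rewrite /esub /= mulr1 !mulN1r mulNr.
have [ij|] := boolP (nonadj i j).
  exists [::] => //; have rel_ij : is_rel zeta t (esub (emul zeta (ex C l i) (ex C l j))
      (emul zeta (ex C l j) (ex C l i))).
    by right; exists i, j.
  apply: in_ideal_coef (eqH_rel u v g rel_ij) => b.
  by rewrite !emul_ex /esub /= !(alpha1l, actw1, gmul1l, mulr1, mulN1r).
rewrite nonadjE negb_and !negbK => /orP[] /eqP ->; first by exists (f0 i).
(* The indices are adjacent in the opposite order, so the relation at [j] is used with its sign
   reversed. *)
exists (escale (-1) (f0 j)); first by rewrite bounded_scale.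
have /(in_ideal_scale (-1)) := adj j; apply: in_ideal_coef => b.
by rewrite !(coef_cat, coef_scale); ring.
Qed.

Lemma word_move u s v i g : exists2 f, bounded (size (u ++ i :: s ++ v)) f &
  eqH (ebas C (u ++ i :: s ++ v, g)) (ebas C (u ++ s ++ i :: v, g) ++ f).
Proof.
elim: s u => [|j s IHs] u; first by exists [::] => //; exact: eqH_coef.
have [f1 b1 e1] := word_swap u (s ++ v) i j g.
have [f2 b2 e2] := IHs (u ++ [:: j]); rewrite -!catA /= in b2 e2.
exists (f2 ++ f1).
  rewrite bounded_cat (_ : size _ = size (u ++ [:: j, i & s ++ v])) ?b2 /=.
    apply: sub_all b1 => p /leq_trans; apply.
    by rewrite !size_cat /= size_cat !addnS ltnS.
  by rewrite !size_cat.
apply: (eqH_trans e1); rewrite (catA _ f2 f1); apply: eqH_cat => //.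
exact: eqH_coef.
Qed.

(** The letters after the first are permuted, then the first is moved to its place in [s']; all
    corrections are shorter than the word. *)
Lemma word_perm u s s' g : perm_eq s s' -> exists2 f, bounded (size (u ++ s)) f &
  eqH (ebas C (u ++ s, g)) (ebas C (u ++ s', g) ++ f).
Proof.
elim: s s' u => [|i s IHs] s' u ss'.
  by move: ss'; rewrite perm_sym => /perm_nilP ->; exists [::] => //; exact: eqH_coef.
have is' : i \in s' by rewrite -(perm_mem ss') mem_head.
move: ss'; case/splitPr: is' => s1 s2 ss'.
have {}ss' : perm_eq s (s1 ++ s2).
  rewrite -(perm_cons i) (perm_trans ss') //.
  exact: (permEl (perm_catCA s1 [:: i] s2)).
have [f1 b1 e1] := IHs _ (u ++ [:: i]) ss'; rewrite -!catA /= in b1 e1.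
have [f2 b2 e2] := word_move u s1 s2 i g.
exists (f2 ++ f1).
  rewrite bounded_cat b1 andbT; congr (is_true (bounded _ _)): b2.
  by rewrite !size_cat /= (perm_size ss') size_cat.
apply: (eqH_trans e1); rewrite (catA _ f2 f1).
by apply: (eqH_cat e2); exact: eqH_coef.
Qed.

Definition ord_le : rel 'I_n := fun i j => (i <= j)%N.

Definition normal f := all (fun p => sorted ord_le p.2.1) f.

Lemma normal_cat f f' : normal (f ++ f') = normal f && normal f'.
Proof. exact: all_cat. Qed.

Lemma normal_scale a f : normal (escale a f) = normal f.
Proof. exact: all_map. Qed.

Lemma ord_le_total : total ord_le.
Proof. by move=> i j; exact: leq_total. Qed.

Lemma ord_le_trans : transitive ord_le.
Proof. by move=> i j k; exact: leq_trans. Qed.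

Lemma ord_le_anti : antisymmetric ord_le.
Proof. by move=> i j ij; apply/val_inj/anti_leq. Qed.

(** Ordered monomials span H: each word is sorted at the cost of shorter words, which the induction
    on [d] straightens, while the inner induction runs through the list. *)
Lemma straighten d f : bounded d f ->
  exists f', [/\ bounded d f', normal f' & eqH f f'].
Proof.
elim: d f => [|d IHd] f.
  by case: f => // _; exists [::]; split=> //; exact: eqH_coef.
elim: f => [_|[a [s g]] f IHf /= /andP[sd /IHf[f' [bf' nf' ff']]]].
  by exists [::]; split=> //; exact: eqH_coef.
have /(word_perm [::] g)[f1 b1 e1] : perm_eq s (sort ord_le s).
  by rewrite perm_sym perm_sort.
have [|f2 [b2 n2 e2]] := IHd f1.
  by apply: sub_all b1 => p /leq_trans; apply.
exists ((a, (sort ord_le s, g)) :: escale a f2 ++ f'); split.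
- rewrite /= size_sort sd -/(bounded _ _) bounded_cat bounded_scale bf' andbT.
  by apply: sub_all b2 => p /leqW.
- rewrite /= -/(normal _) normal_cat normal_scale n2 nf' !andbT.
  exact: (sort_sorted ord_le_total).
rewrite -cat1s -[X in eqH _ X]cat1s (catA _ _ f'); apply: eqH_cat => //.
have : eqH (ebas C (s, g)) (ebas C (sort ord_le s, g) ++ f2).
  apply: (eqH_trans e1); apply: eqH_cat => //; exact: eqH_coef.
move=> /(eqH_scale a); apply: in_ideal_coef => b.
by rewrite /esub /ebas !(coef_cat, coef_scale, coef_cons, coef_nil); ring.
Qed.

End Straightening.

(** * The center *)

Section Center.
Variables (C : fieldType) (m l : nat) (zeta : C) (t : 'I_m.+3 -> C).
Hypotheses (l_gt1 : (1 < l)%N) (zeta_prim : l.-primitive_root zeta).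
Local Notation n := m.+3.
Local Notation elt := (elt C n l).
Local Notation basis := (basis n l).
Local Notation grp := {ffun 'I_n.-1 -> 'Z_l}.
Local Notation K := ({ffun 'I_n -> int} * grp)%type.
Local Notation eqH := (eqH zeta t).
Variable S : twisted_algebra (torus_bichar m l_gt1 zeta_prim).
Local Notation mon := (@twmon _ _ _ S).
Local Notation co := (@twcoef _ _ _ S).
Local Notation tx := (tx S).
Local Notation tv := (tv t S).
Local Notation tX := (tX t S).
Local Notation tg := (tg S).
Local Notation phi := (phi t S).
Local Notation phib := (phib t S).
Implicit Types (s : seq 'I_n) (f z : elt) (i j : 'I_n) (k : K) (b : basis).

Definition deg k : int := \sum_j k.1 j.

Lemma degD k k' : deg (k + k') = deg k + deg k'.
Proof. by rewrite /deg -big_split; apply: eq_bigr => j _; rewrite ffunE. Qed.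

Definition cnt s : {ffun 'I_n -> int} := \sum_(i <- s) ev i.

Lemma cntE s j : cnt s j = (count_mem j s)%:R.
Proof.
rewrite /cnt; elim: s => [|i s IHs]; first by rewrite big_nil ffunE.
by rewrite big_cons ffunE IHs /= natrD ffunE eq_sym.
Qed.

Lemma cnt_perm s s' : cnt s = cnt s' -> perm_eq s s'.
Proof.
move=> ss'; apply/allP => i _ /=; move/ffunP/(_ i): ss'.
by rewrite !cntE => /eqP; rewrite eqr_nat.
Qed.

Lemma deg_ev i g : deg (ev i, g) = 1.
Proof.
rewrite /deg (bigD1 i) //= ffunE eqxx big1 ?addr0 // => j /negPf ji.
by rewrite ffunE ji.
Qed.

Lemma deg_cnt s g : deg (cnt s, g) = (size s)%:Z.
Proof.
elim: s => [|i s IHs]; first by rewrite /deg big1 // => j _; rewrite cntE.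
rewrite (_ : (cnt (i :: s), g) = (ev i, 0) + (cnt s, g)).
  by rewrite degD deg_ev IHs.
by rewrite /cnt big_cons; congr (_, _); rewrite add0r.
Qed.

Lemma deg_lt_tv i : deg_lt deg 0 (tv i).
Proof.
apply: deg_ltZ; apply: deg_lt_twmon.
rewrite (_ : deg _ = - deg (ev (ordS i), 0)); first by rewrite deg_ev.
by rewrite /deg -sumrN; apply: eq_bigr => j _; rewrite ffunE.
Qed.

Lemma leads_tX i : leads deg (ev i, 0) (tX i).
Proof.
rewrite /leads /tX addrC addrA addNr add0r deg_ev.
exact: deg_lt_le (deg_lt_tv i).
Qed.

Lemma bichar_group1l q k : torus_bichar m l_gt1 zeta_prim (q, 0) k = 1.
Proof. by rewrite torus_bicharE wexp_group1l zp0. Qed.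

Lemma leads_prod (I : Type) (r : seq I) (F : I -> S) (q : I -> {ffun 'I_n -> int}) :
  (forall y, leads deg (q y, 0) (F y)) ->
  leads deg (\sum_(y <- r) q y, 0) (\prod_(y <- r) F y).
Proof.
move=> qF; elim: r => [|y r IHr].
  rewrite !big_nil /leads (_ : (0, 0) = 0 :> K) // twmon0 subrr => k _.
  exact: twcoef0.
rewrite !big_cons (_ : (_, _) = (q y, 0) + (\sum_(y' <- r) q y', 0)).
  by apply: leadsM => //; [exact: degD | exact: bichar_group1l].
by congr (_, _); rewrite add0r.
Qed.

Lemma leads_phib b : leads deg (cnt b.1, b.2) (phib b).
Proof.
rewrite (_ : (_, _) = (cnt b.1, 0) + (0, b.2) :> K).
  apply: leadsM; [exact: degD | | | exact: bichar_group1l].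
    by apply: leads_prod => i; exact: leads_tX.
  by rewrite /leads /tg subrr => k _; exact: twcoef0.
by congr (_, _); [rewrite addr0 | rewrite add0r].
Qed.

Lemma leads_phi_w : leads deg (\sum_i ev i, 0) (phi (w l zeta t)).
Proof.
have -> : \sum_i ev i = cnt (enum 'I_n) by rewrite /cnt big_enum.
have txE : \prod_i tx i = mon (cnt (enum 'I_n), 0).
  rewrite -prodr_enum /cnt; elim: (enum 'I_n) => [|i r IHr].
    by rewrite !big_nil -twmon0.
  rewrite !big_cons IHr /tx monM wexp_group1l zp0 scale1r.
  by congr (mon (_, _)); rewrite add0r.
rewrite /leads phi_w txE addrC addrA addNr add0r deg_cnt.
have /(deg_lt_le (d' := (size (enum 'I_n))%:Z)) H : deg_lt deg 0 (\prod_i tv i).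
  (* A possibly empty product of the v only has degree at most 0; splitting off the first factor
     makes the full product negative. *)
  suff H r : deg_lt deg 1 (\prod_(i <- r) tv i).
    rewrite big_ord_recl; apply: (@deg_lt_le _ _ _ _ _ (0 + 0)) => //.
    apply: (deg_ltM degD (deg_lt_tv _)).
    by rewrite -(big_map (lift ord0) xpredT tv) add0r; exact: H.
  elim: r => [|i r IHr].
    rewrite big_nil -twmon0; apply: deg_lt_twmon.
    by rewrite /deg big1 // => j _; rewrite ffunE.
  rewrite big_cons; apply: (@deg_lt_le _ _ _ _ _ (0 + 0)) => //.
  by apply: deg_ltM; [exact: degD|exact: deg_lt_tv|].
exact: H.
Qed.

Definition words f := undup [seq p.2 | p <- f].

Lemma phi_words f : phi f = \sum_(b <- words f) coef f b *: phib b.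
Proof.
by apply: big_coefE; rewrite ?undup_uniq // => p pf; rewrite mem_undup map_f.
Qed.

Lemma coef_notin f b : b \notin words f -> coef f b = 0.
Proof.
move=> bf; rewrite /coef big_seq_cond big1 // => p /andP[pf /eqP pb].
by move: bf; rewrite -pb mem_undup map_f.
Qed.

Lemma words_bounded d f b : bounded d f -> b \in words f -> (size b.1 < d)%N.
Proof. by move=> /allP bf; rewrite mem_undup => /mapP[p /bf pd ->]. Qed.

Lemma words_normal f b : normal f -> b \in words f -> sorted (@ord_le m) b.1.
Proof. by move=> /allP nf; rewrite mem_undup => /mapP[p /nf pd ->]. Qed.

(** Triangularity: a word no longer than [b.1] can contribute here only through its leading
    monomial, and sorted words with equal exponents coincide; the coefficients of longer words are 0
    by assumption. *)
Lemma coef_phi f b : normal f -> sorted (@ord_le m) b.1 ->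
  (forall b', b' \in words f -> (size b.1 < size b'.1)%N -> coef f b' = 0) ->
  co (cnt b.1, b.2) (phi f) = coef f b.
Proof.
move=> nf sb big0; rewrite phi_words linear_sum /=.
have coE b' : b' \in words f ->
    co (cnt b.1, b.2) (coef f b' *: phib b') = coef f b' * (b' == b)%:R.
  move=> b'f; rewrite twcoefZ.
  have [le|/big0->//] := leqP (size b'.1) (size b.1); last by rewrite !mul0r.
  rewrite (leads_coef (@leads_phib b')) ?deg_cnt ?lez_nat //.
  congr (_ * (nat_of_bool _)%:R); apply/eqP/eqP => [[/cnt_perm pb eg]|->//].
  have := sorted_eq (@ord_le_trans m) (@ord_le_anti m) (words_normal nf b'f) sb pb.
  by case: b' b eg {big0 sb b'f le pb} => [? ?] [? ?] /= -> ->.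
rewrite big_seq (eq_bigr _ coE) -big_seq.
have [bf|bf] := boolP (b \in words f); last first.
  rewrite coef_notin // big1_seq // => b' /andP[_ b'f].
  by case: eqP b'f bf => [-> ->|]; rewrite ?mulr0.
rewrite (bigD1_seq b) ?undup_uniq //= eqxx mulr1 big1 ?addr0 // => b' /negPf->.
by rewrite mulr0.
Qed.

(** Degree in S controls word length in H: after straightening, the coefficients of words of length
    at least [d] are read off from [phi z] and vanish. *)
Lemma normal_form d z : deg_lt deg d%:Z (phi z) ->
  exists f, [/\ bounded d f, normal f & eqH z f].
Proof.
move=> dz; pose e := (\max_(p <- z) size p.2.1).+1.
have bz : bounded e z by apply/allP => p pz; rewrite ltnS; apply: leq_bigmax_seq.
have [f [bf nf zf]] := straighten t l_gt1 zeta_prim bz.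
rewrite (phi_eqH S zf) in dz.
(* Descending induction on the length of the word, [r] bounding its distance to [e]. *)
have coef0 r b : sorted (@ord_le m) b.1 -> (d <= size b.1)%N ->
    (e <= size b.1 + r)%N -> coef f b = 0.
  elim: r b => [|r IHr] b sb db eb.
    apply: coef_notin; apply/negP => /(words_bounded bf).
    by rewrite ltnNge -[size _]addn0 eb.
  rewrite -(coef_phi nf sb) ?dz ?deg_cnt ?lez_nat // => b' b'f bb'.
  apply: IHr; first exact: words_normal b'f.
    exact: leq_trans (ltnW bb').
  by rewrite (leq_trans eb) // addnS -addSn leq_add2r.
(* Discarded entries may be nonzero one by one, but for each basis element their coefficients add up
   to 0. *)
exists [seq p <- f | (size p.2.1 < d)%N]; split.
- exact: filter_all.
- by apply/allP => p; rewrite mem_filter => /andP[_ pf]; exact: (allP nf).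
apply: (eqH_trans zf); apply: eqH_coef => b.
rewrite /coef big_filter_cond.
have [bd|db] := ltnP (size b.1) d.
  by apply: eq_bigl => p; case: eqP => [->|]; rewrite ?bd ?andbF.
rewrite [RHS]big1 => [|p /andP[pd /eqP pb]]; last by rewrite pb ltnNge db in pd.
have [bw|/coef_notin//] := boolP (b \in words f).
by apply: (coef0 e b); [exact: words_normal bw | | exact: leq_addl].
Qed.

(** At the bound 0 no word is short enough, so the normal form of the difference is the empty
    list. *)
Lemma phi_inj z z' : phi z = phi z' -> eqH z z'.
Proof.
move=> zz'; have [|f [bf _ zf]] := @normal_form 0 (esub z z').
  by rewrite phi_sub zz' subrr => k _; exact: twcoef0.
case: f bf zf => // _; apply: in_ideal_coef => b.
by rewrite /esub !(coef_cat, coef_scale, coef_nil) mulr0 addr0.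
Qed.

Lemma central_phi z : central zeta t z <-> forall y : elt, GRing.comm (phi z) (phi y).
Proof.
split=> [zC y|zC y]; first by have /(phi_eqH S) := zC y; rewrite !phi_mul.
by apply: phi_inj; rewrite !phi_mul zC.
Qed.

Lemma in_subalg_phi z : in_subalg zeta t z <->
  exists r : seq (C * seq (option 'I_n)),
    phi z = \sum_(c <- r) c.1 *: phi (emonom l zeta t c.2).
Proof.
split=> -[r zr]; exists r.
  by rewrite (phi_eqH S zr) phi_flatten; apply: eq_bigr => c _; rewrite phi_scale.
apply: phi_inj; rewrite zr phi_flatten.
by apply: eq_bigr => c _; rewrite phi_scale.
Qed.

Lemma phi_emonom_comm r y : GRing.comm (phi (emonom l zeta t r)) (phi y).
Proof.
rewrite phi_emonom; apply/commr_sym/commr_prod => o _; apply/commr_sym.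
exact: phi_gens_comm.
Qed.

(** G acts faithfully: weights are successive differences of coordinates, and the coordinate
    cyclically before the first is the last one, which is 0. *)
Lemma wt_eq0 (g : grp) : (forall i, wt g i = 0) -> g = 0.
Proof.
move=> g0; have Gn : G g m.+2 = 0 by apply: G_ge.
have Gj (j : nat) : (j < n)%N -> G g j = 0.
  elim: j => [|j IHj] jn.
    by have := g0 (Ordinal jn); rewrite /wt val_ord_pred /= Gn subr0.
  have := g0 (Ordinal jn); rewrite /wt val_ord_pred /= IHj ?subr0 //.
  exact: ltnW.
apply/ffunP => k; rewrite ffunE -(Gj k); last exact: ltn_trans (ltn_ord k) _.
by rewrite (G_lt g (ltn_ord k)); congr (g _); apply/val_inj.
Qed.

(** * Top-degree terms of a central element *)

Section CentralTopDegree.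
Variables (e : nat) (z : elt) (b : basis).
Hypotheses (zC : forall y : elt, GRing.comm (phi z) (phi y)).
Hypotheses (ez : deg_lt deg e.+1%:Z (phi z)) (be : size b.1 = e).
Hypothesis b_neq0 : co (cnt b.1, b.2) (phi z) != 0.

(** Commuting with X_i is compared at the top monomial times x_i: the same nonzero coefficient
    appears with and without the scalar by which the group part acts on x_i. So all its weights are
    0. *)
Lemma top_group1 : b.2 = 0.
Proof.
apply: wt_eq0 => i; apply: (zp_inj l_gt1 zeta_prim); rewrite zp0.
pose k : K := (cnt b.1, b.2); pose k' : K := k + (ev i, 0).
have ek' : e%:Z <= deg k' by rewrite degD deg_cnt deg_ev be lerDl.
have kk' : k' - (ev i, 0) = k by rewrite /k' addrK.
have := congr1 (co k') (zC (ex C l i)); rewrite phi_ex mulrDl mulrDr !twcoefD.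
(* [tv i] has negative degree, so both products with it stay below degree [e], whereas [k'] has
   degree [e + 1]. *)
rewrite (deg_ltM degD (d := e.+1%:Z) (d' := -1) ez (deg_lt_tv i)); last first.
  by rewrite (le_trans _ ek') //; lia.
rewrite (deg_ltM degD (d := 0) (d' := e%:Z) (deg_lt_tv i)); first last.
- by rewrite add0r.
- by rewrite (_ : e%:Z + 1 = e.+1%:Z) //; lia.
rewrite !addr0 twcoefM_mon twcoef_monM kk' bichar_group1l mul1r torus_bicharE.
rewrite -[RHS]mulr1 => /(mulfI b_neq0) <-; congr (zp zeta _).
by rewrite /wexp /= pairing0r subr0 sum_ev.
Qed.

(** The group part being trivial, commuting with g_j forces zeta^(s_j - s_{j+1}) = 1 for the
    exponents s of the top monomial; these congruences propagate from index 0. *)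
Lemma top_residue i : count_mem i b.1 = count_mem ord0 b.1 %[mod l].
Proof.
have step j : ((count_mem j b.1)%:R : 'Z_l) = (count_mem (ordS j) b.1)%:R.
  pose k : K := (cnt b.1, 0); pose k' : K := k + (0, gen_g l j).
  have := congr1 (co k') (zC (eg C (gen_g l j))); rewrite phi_eg /tg.
  have kk' : k' - (0, gen_g l j) = k by rewrite /k' addrK.
  rewrite twcoefM_mon twcoef_monM kk' bichar_group1l mulr1 torus_bicharE.
  move: b_neq0; rewrite top_group1 -/k => k_neq0.
  rewrite -[LHS]mul1r => /(mulIf k_neq0); rewrite -(zp0 l zeta).
  move/(zp_inj l_gt1 zeta_prim) => /esym.
  rewrite /wexp /= pairing0r subr0 sum_wt_gen !cntE !rmorph_nat.
  by move/eqP; rewrite subr_eq0 => /eqP.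
have Zl (a c : nat) : (a%:R : 'Z_l) = c%:R -> a = c %[mod l].
  by move/(congr1 val); rewrite /= !val_Zp_nat.
apply: Zl; rewrite -[i]inord_val; elim: (val i) (ltn_ord i) => [|j IHj] jn.
  by congr ((count_mem _ _)%:R); apply/val_inj; rewrite /= inordK.
rewrite -IHj ?(ltnW jn) // [RHS]step; congr ((count_mem _ _)%:R).
apply/val_inj; rewrite val_ordS /= !inordK ?(ltnW jn) //.
by case: eqP => [ej|//]; lia.
Qed.

End CentralTopDegree.

(** For exponents r + l q_i with common residue r, this encodes w^r times the product of the
    (x_i^l)^(q_i), whose leading monomial is that of [s]. *)
Definition top_monom s : seq (option 'I_n) :=
  nseq (count_mem ord0 s %% l) None ++
  flatten [seq nseq (count_mem i s %/ l) (Some i) | i <- enum 'I_n].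

Lemma leads_top_monom s :
  (forall i, count_mem i s = count_mem ord0 s %[mod l]) ->
  leads deg (cnt s, 0) (phi (emonom l zeta t (top_monom s))).
Proof.
move=> res; rewrite phi_emonom.
pose q (o : option 'I_n) := if o is Some i then ev i *+ l else \sum_i ev i.
have -> : cnt s = \sum_(o <- top_monom s) q o.
  have sum_nseq a o : \sum_(o' <- nseq a o) q o' = q o *+ a.
    by rewrite big_nseq iter_addr_0.
  apply/ffunP => j; rewrite cntE /top_monom big_cat big_flatten big_map big_enum /=.
  rewrite sum_nseq [X in _ + X](eq_bigr (fun i => ev i *+ (count_mem i s %/ l * l))).
    rewrite ffunE ffunMnE !sum_ffunE (bigD1 j) //= [X in _ + X](bigD1 j) //=.
    rewrite !big1 => [|i ij|i ij].
    - rewrite !ffunMnE !ffunE eqxx !addr0 -natrD.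
      by rewrite {1}(divn_eq (count_mem j s) l) res addnC.
    - by rewrite ffunMnE ffunE eq_sym (negPf ij) mul0rn.
    - by rewrite ffunE eq_sym (negPf ij).
  by move=> i _; rewrite sum_nseq /= mulnC mulrnA.
apply: leads_prod => -[i|] /=; last exact: leads_phi_w.
rewrite phi_gens_Some.
suff H (a : nat) : leads deg (ev i *+ a, 0) (tX i ^+ a) by exact: H.
elim: a => [|a IHa].
  rewrite expr0 mulr0n /leads (_ : (0, 0) = 0 :> K) // twmon0 subrr => k _.
  exact: twcoef0.
rewrite exprS mulrS (_ : (_, _) = (ev i, 0) + (ev i *+ a, 0)).
  by apply: leadsM; [exact: degD|exact: leads_tX| |exact: bichar_group1l].
by congr (_, _); rewrite add0r.
Qed.

(** Subtracting, for each word of length [e], the multiple of its [top_monom] lowers the degree and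
    keeps the element commuting with the image of [phi]. *)
Lemma central_in_subalg e z : (forall y : elt, GRing.comm (phi z) (phi y)) ->
  deg_lt deg e%:Z (phi z) ->
  exists r : seq (C * seq (option 'I_n)),
    phi z = \sum_(c <- r) c.1 *: phi (emonom l zeta t c.2).
Proof.
elim: e z => [|e IHe] z zC ez; have [f [bf nf zf]] := normal_form ez.
  by case: f bf zf {nf} => // _ /(phi_eqH S) ->; exists [::]; rewrite /phi !big_nil.
have phi_zf := phi_eqH S zf.
pose T := [seq b <- words f | size b.1 == e].
pose z' := esub z (flatten
  [seq escale (coef f b) (emonom l zeta t (top_monom b.1)) | b <- T]).
have phi_z' : phi z' = phi z -
    \sum_(b <- T) coef f b *: phi (emonom l zeta t (top_monom b.1)).
  rewrite phi_sub phi_flatten; congr (_ - _).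
  by apply: eq_bigr => b _; rewrite phi_scale.
have [|| r z'r] := IHe z'.
- move=> y; rewrite phi_z'; apply/commr_sym/commrB; first exact/commr_sym.
  apply: commr_sum => b _; rewrite /GRing.comm -scalerAr -scalerAl.
  by rewrite phi_emonom_comm.
- rewrite phi_z' phi_zf phi_words (bigID (fun b : basis => size b.1 == e)) /=.
  rewrite -big_filter -/T addrAC -sumrB; apply: deg_ltD; last first.
    rewrite big_seq_cond; apply: deg_lt_sum => b /andP[bw ne]; apply: deg_ltZ.
    apply: deg_lt_le (leads_deg_lt (@leads_phib b)).
    have := words_bounded bf bw; rewrite ltnS leq_eqVlt (negPf ne) /= => lt.
    by rewrite deg_cnt; lia.
  rewrite big_seq; apply: deg_lt_sum => b; rewrite mem_filter => /andP[/eqP be bw].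
  (* [words f] may list words whose coefficients cancel; the results on top terms concern nonzero
     coefficients. *)
  have [->|c0] := eqVneq (coef f b) 0.
    by rewrite !scale0r subrr => k _; exact: twcoef0.
  have cb : co (cnt b.1, b.2) (phi z) = coef f b.
    rewrite phi_zf coef_phi ?(words_normal nf bw) // => b' b'f; rewrite be => lt.
    by have := words_bounded bf b'f; rewrite ltnNge lt.
  rewrite -cb in c0; have b2 := top_group1 zC ez be c0.
  have bl := @leads_phib b; rewrite b2 in bl.
  have tl := leads_top_monom (top_residue zC ez be c0).
  (* Both images have the same top-degree part, so their difference drops below degree [e]. *)
  rewrite -scalerBr; apply: deg_ltZ.
  rewrite -[phib b](subrK (mon (cnt b.1, 0))) -addrA -[mon _ - _]opprB; apply: deg_ltD.
    by move: bl; rewrite /leads deg_cnt be.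
  by rewrite -scaleN1r; apply: deg_ltZ; move: tl; rewrite /leads deg_cnt be.
exists ([seq (coef f b, top_monom b.1) | b <- T] ++ r).
by rewrite big_cat big_map /= -z'r phi_z' addrC subrK.
Qed.

Lemma center_generated z : central zeta t z <-> in_subalg zeta t z.
Proof.
split=> [/central_phi zC|/in_subalg_phi[r zr]].
  apply/in_subalg_phi; pose e := (\max_(p <- z) size p.2.1).+1.
  apply: (@central_in_subalg e) => //; rewrite /phi big_seq.
  apply: deg_lt_sum => p pz; apply: deg_ltZ.
  apply: deg_lt_le (leads_deg_lt (@leads_phib p.2)).
  have : (size p.2.1 < e)%N by rewrite ltnS; apply: leq_bigmax_seq.
  by rewrite deg_cnt lezD1 ltz_nat.
apply/central_phi => y; rewrite zr; apply/commr_sym/commr_sum => c _.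
by rewrite /GRing.comm -scalerAr -scalerAl phi_emonom_comm.
Qed.

End Center.

Theorem theorem1p2 (C : numClosedFieldType) (n l : nat) (zeta : C) (t : 'I_n -> C) :
  (3 <= n)%N -> (2 <= l)%N -> l.-primitive_root zeta ->
  forall z : elt C n l, central zeta t z <-> in_subalg zeta t z.
Proof.
case: n t => [|[|[|m]]] // t _ l_gt1 zeta_prim z.
(* [S] does not occur in the statement; the concrete twisted group algebra supplies it. *)
exact: (center_generated t (twisted_group_algebra (torus_bichar m l_gt1 zeta_prim))).
Qed.
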